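(* Let $\mathrm{R}$ be an integral domain of characteristic different from $2$ in which $2$ is invertible, let $q\in\mathrm{R}^\times\setminus\{\pm1\}$ be such that $q+q^{-1}\in\mathrm{R}^\times$, and let $n\geq1$. Then the two trace functions $\gimel^{\mathrm{R}}_n$ and $t^{\mathrm{R}}_{1,n}$ on the Hecke-Clifford superalgebra $\mathcal{HC}_{\mathrm{R}}(n)$ satisfy $$\gimel^{\mathrm{R}}_n=\frac{1}{2^n}\,t^{\mathrm{R}}_{1,n}.$$
   Context: Put $\epsilon=q-q^{-1}$. $\mathcal{HC}_{\mathrm{R}}(n)$ is the $\mathrm{R}$-superalgebra generated by even $T_1,\ldots,T_{n-1}$ and odd $C_1,\ldots,C_n$ with relations $T_i^2=\epsilon T_i+1$, $T_iT_j=T_jT_i$ ($|i-j|>1$), $T_iT_{i+1}T_i=T_{i+1}T_iT_{i+1}$, $C_i^2=1$, $C_iC_j=-C_jC_i$ ($i\ne j$), $T_iC_i=C_{i+1}T_i$, $T_iC_{i+1}=C_iT_i-\epsilon(C_i-C_{i+1})$, $T_iC_j=C_jT_i$ ($j\neq i,i+1$). (It is the quotient of the affine Hecke-Clifford superalgebra by the two-sided ideal generated by $X_1-1$.) It is free over $\mathrm{R}$ with basis $C^\beta T_w$, $\beta\in\mathbb{Z}_2^n$, $w\in\mathfrak{S}_n$, where $C^\beta=C_1^{\beta_1}\cdots C_n^{\beta_n}$ and $T_w$ is the product of $T_i$'s along a reduced word of $w$. The images in $\mathcal{HC}_{\mathrm{R}}(n)$ of the affine generators $X_1,\ldots,X_n$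 are given by $X_1=1$ and $X_{i+1}=(T_i+\epsilon C_iC_{i+1})X_iT_i$. Form $t^{\mathrm{R}}_{1,n}$: let $\tau^{\mathrm{R}}_{1,n}$ be the $\mathrm{R}$-linear form with $\tau^{\mathrm{R}}_{1,n}(C^\beta T_w)=\delta_{(\beta,w),(0,1)}$. Then $t^{\mathrm{R}}_{1,n}(h)=\tau^{\mathrm{R}}_{1,n}\big(h(1+X_1)(1+X_2)\cdots(1+X_n)\big)$. Form $\gimel^{\mathrm{R}}_n$: a trace function is an ($\mathrm{R}$-linear) map $\phi:\mathcal{HC}_{\mathrm{R}}(n)\to\mathrm{R}$ with $\phi(ab)=\phi(ba)$ for all even elements $a,b\in\mathcal{HC}_{\mathrm{R}}(n)_{\bar0}$ and $\phi(\mathcal{HC}_{\mathrm{R}}(n)_{\bar1})=0$. Let $\mathcal{OP}_n$ be the set of partitions $\nu=(\nu_1,\ldots,\nu_\ell)$ of $n$ all of whose (nonzero) parts are odd, let $\ell(\nu)=\ell$, and for $\nu\in\mathcal{OP}_n$ let $w_\nu\in\mathfrak{S}_n$ be the Coxeter element of the Young subgroup $\mathfrak{S}_{\nu_1}\times\cdots\times\mathfrak{S}_{\nu_\ell}$ obtained by multiplying, in increasing order, all $s_i=(i,i+1)$ with $1\le i\le n-1$ and $i\notin\{\nu_1,\nu_1+\nu_2,\ldots,\nu_1+\cdots+\nu_{\ell-1}\}$. By a theorem of Wan and Wang every trace function is uniquely determined by its values on the $T_{w_\nu}$, $\nu\in\mathcal{OP}_n$, and $\gimel^{\mathrm{R}}_n$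 is the trace function characterized by $\gimel^{\mathrm{R}}_n(T_{w_\nu})=\big(\frac{q^2-1}{2}\big)^{n-\ell(\nu)}$ for all $\nu\in\mathcal{OP}_n$ and $\gimel^{\mathrm{R}}_n(z)=0$ for all $z\in\mathcal{HC}_{\mathrm{R}}(n)_{\bar1}$.
   Formalization: The value of ℷ_n at T_{w_ν} is corrected to ((q−q^{-1})/2)^{n−ℓ(ν)} (the stated ((q²−1)/2)^{n−ℓ(ν)} fails for n=3), and trace functions are required to satisfy φ(ab)=φ(ba) for all a,b, since with even a,b only ℷ_n is not uniquely determined. *)

(* Defs.v *)
From HB Require Import structures.
From mathcomp Require Import all_boot all_algebra all_fingroup.
From mathcomp Require Import boolp classical_sets.
From mathcomp.multinomials Require Import monalg.

Set Implicit Arguments.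
Unset Strict Implicit.
Unset Printing Implicit Defensive.

Import GRing.Theory.
Local Open Scope ring_scope.

(* Indices are shifted by one: i : 'I_n.-1 stands for T_{i+1} and i : 'I_n for
   C_{i+1}.  Then C_i and C_{i+1} of the usual relations involving T_i become
   C (pos0 i) and C (pos1 i). *)
Definition pos0 (n : nat) (i : 'I_n.-1) : 'I_n := widen_ord (leq_pred n) i.

Lemma pos1_subproof (n : nat) (i : 'I_n.-1) : (i.+1 < n)%N.
Proof. by rewrite -ltn_predRL. Qed.

Definition pos1 (n : nat) (i : 'I_n.-1) : 'I_n := Ordinal (pos1_subproof i).

Definition epsilon (R : idomainType) (q : R) : R := q - q^-1.

Section HeckeClifford.

Variables (R : idomainType) (q : R) (n : nat).

(* fingroup's repr shadows the one of generic_quotient *)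
Local Notation repr := generic_quotient.repr.
Local Notation eps := (epsilon q).

(* inl i is the even generator T_{i+1}, inr j the odd generator C_{j+1} *)
Definition generator : choiceType := ('I_n.-1 + 'I_n)%type.

Definition free_alg : Type := {malg R[{fmonom generator}]}.

HB.instance Definition _ := GRing.Lalgebra.on free_alg.

Definition freeT (i : 'I_n.-1) : free_alg := << fmu (inl i : generator) >>.
Definition freeC (j : 'I_n) : free_alg := << fmu (inr j : generator) >>.

Local Notation T := freeT.
Local Notation C := freeC.

Inductive HC_relation : free_alg -> free_alg -> Prop :=
| HC_quadratic i : HC_relation (T i ^+ 2) (eps *: T i + 1)
| HC_commute (i j : 'I_n.-1) : (i.+1 < j)%N || (j.+1 < i)%N ->
    HC_relation (T i * T j) (T j * T i)
| HC_braid (i j : 'I_n.-1) : j = i.+1 :> nat ->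
    HC_relation (T i * T j * T i) (T j * T i * T j)
| HC_Clifford_sqr i : HC_relation (C i ^+ 2) 1
| HC_Clifford_anti i j : i != j -> HC_relation (C i * C j) (- (C j * C i))
| HC_TC0 i : HC_relation (T i * C (pos0 i)) (C (pos1 i) * T i)
| HC_TC1 i : HC_relation (T i * C (pos1 i))
    (C (pos0 i) * T i - eps *: (C (pos0 i) - C (pos1 i)))
| HC_TC i j : j != pos0 i -> j != pos1 i -> HC_relation (T i * C j) (C j * T i).

Inductive HC_ideal : free_alg -> Prop :=
| HC_ideal0 : HC_ideal 0
| HC_idealD g h : HC_ideal g -> HC_ideal h -> HC_ideal (g + h)
| HC_ideal_rel a b g h : HC_relation g h -> HC_ideal (a * (g - h) * b).

Lemma HC_idealMl a g : HC_ideal g -> HC_ideal (a * g).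
Proof.
elim=> [|{}g h _ IHg _ IHh|c b {}g h r].
- by rewrite mulr0; apply: HC_ideal0.
- by rewrite mulrDr; apply: HC_idealD.
- by rewrite !mulrA; apply: HC_ideal_rel.
Qed.

Lemma HC_idealMr b g : HC_ideal g -> HC_ideal (g * b).
Proof.
elim=> [|{}g h _ IHg _ IHh|c a {}g h r].
- by rewrite mul0r; apply: HC_ideal0.
- by rewrite mulrDl; apply: HC_idealD.
- by rewrite -mulrA; apply: HC_ideal_rel.
Qed.

Lemma HC_idealZ c g : HC_ideal g -> HC_ideal (c *: g).
Proof. by move=> Ig; rewrite -[g]mul1r scalerAl; apply: HC_idealMl. Qed.

Definition HC_ideal_pred : {pred free_alg} := fun g => `[< HC_ideal g >].

Lemma HC_ideal_zmod_closed : zmod_closed HC_ideal_pred.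
Proof.
split=> [|g h]; rewrite !unfold_in; first exact/asboolP/HC_ideal0.
move=> /asboolP Ig /asboolP Ih; apply/asboolP; apply: HC_idealD => //.
by rewrite -mulN1r; apply: HC_idealMl.
Qed.

HB.instance Definition _ :=
  GRing.isZmodClosed.Build free_alg HC_ideal_pred HC_ideal_zmod_closed.

Definition HC := Quotient.quot HC_ideal_pred.

HB.instance Definition _ := GRing.Zmodule.on HC.

Definition HC_pi (g : free_alg) : HC := \pi_HC%qT g.

Lemma HC_piP g h : reflect (HC_ideal (g - h)) (HC_pi g == HC_pi h).
Proof. by rewrite -Quotient.idealrBE; apply: asboolP. Qed.

Lemma HC_pi_repr (x : HC) : HC_pi (repr x) = x.
Proof. exact: reprK. Qed.

Definition HC_one : HC := HC_pi 1.
Definition HC_mul (x y : HC) : HC := HC_pi (repr x * repr y).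
Definition HC_scale (c : R) (x : HC) : HC := HC_pi (c *: repr x).

Lemma HC_piM g h : HC_mul (HC_pi g) (HC_pi h) = HC_pi (g * h).
Proof.
apply/eqP/HC_piP; set g' := repr _; set h' := repr _.
have -> : g' * h' - g * h = (g' - g) * h' + g * (h' - h).
  by rewrite mulrBl mulrBr addrA subrK.
by apply: HC_idealD; [apply: HC_idealMr | apply: HC_idealMl]; apply/HC_piP/eqP;
  rewrite HC_pi_repr.
Qed.

Lemma HC_piZ c g : HC_scale c (HC_pi g) = HC_pi (c *: g).
Proof.
apply/eqP/HC_piP; rewrite -scalerBr.
by apply/HC_idealZ/HC_piP/eqP; rewrite HC_pi_repr.
Qed.

Lemma HC_mulA : associative HC_mul.
Proof.
move=> x y z; rewrite -[x]HC_pi_repr -[y]HC_pi_repr -[z]HC_pi_repr.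
by rewrite !HC_piM mulrA.
Qed.

Lemma HC_mul1 : left_id HC_one HC_mul.
Proof. by move=> x; rewrite -[x]HC_pi_repr HC_piM mul1r. Qed.

Lemma HC_mulr1 : right_id HC_one HC_mul.
Proof. by move=> x; rewrite -[x]HC_pi_repr HC_piM mulr1. Qed.

Lemma HC_piD : {morph HC_pi : g h / g + h}.
Proof. by move=> g h; rewrite /HC_pi !piE. Qed.

Lemma HC_mulDl : left_distributive HC_mul +%R.
Proof.
move=> x y z; rewrite -[x]HC_pi_repr -[y]HC_pi_repr -[z]HC_pi_repr.
by rewrite -HC_piD !HC_piM mulrDl HC_piD.
Qed.

Lemma HC_mulDr : right_distributive HC_mul +%R.
Proof.
move=> x y z; rewrite -[x]HC_pi_repr -[y]HC_pi_repr -[z]HC_pi_repr.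
by rewrite -HC_piD !HC_piM mulrDr HC_piD.
Qed.

(* HC is only declared as a pzRingType and an lmodType: algType would require a
   proof of 1 != 0. *)
HB.instance Definition _ := GRing.Zmodule_isPzRing.Build HC
  HC_mulA HC_mul1 HC_mulr1 HC_mulDl HC_mulDr.

Lemma HC_scaleA a b x : HC_scale a (HC_scale b x) = HC_scale (a * b) x.
Proof. by rewrite -[x]HC_pi_repr !HC_piZ scalerA. Qed.

Lemma HC_scale1 : left_id 1 HC_scale.
Proof. by move=> x; rewrite -[x]HC_pi_repr HC_piZ scale1r. Qed.

Lemma HC_scaleDr : right_distributive HC_scale +%R.
Proof.
move=> a x y; rewrite -[x]HC_pi_repr -[y]HC_pi_repr.
by rewrite -HC_piD !HC_piZ scalerDr HC_piD.
Qed.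

Lemma HC_scaleDl x : {morph HC_scale^~ x : a b / a + b}.
Proof.
by move=> a b; rewrite -[x]HC_pi_repr !HC_piZ scalerDl HC_piD.
Qed.

HB.instance Definition _ := GRing.Zmodule_isLmodule.Build R HC
  HC_scaleA HC_scale1 HC_scaleDr HC_scaleDl.

Definition HC_T (i : 'I_n.-1) : HC := HC_pi (T i).
Definition HC_C (j : 'I_n) : HC := HC_pi (C j).

(* parity p h: h belongs to the even (p = false) or odd (p = true) part *)
Definition has_parity (p : bool) (h : HC) : Prop :=
  exists2 g : free_alg, HC_pi g = h &
    forall m : {fmonom generator}, mcoeff m g != 0 ->
      odd (count (fun x : generator => if x is inr _ then true else false) m)
        = p.

(* The identity phi (a * b) = phi (b * a) is required for all a and b, not only
   for even ones.  With even a and b only, phi would not be determined by its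
   values on the T_{w_nu}: for n = 3, generic q and R a large enough field, the
   even part is isomorphic to M_4 x M_2 x M_2, which carries three independent
   traces, but there are only two nu. *)
Definition is_trace (phi : {scalar HC}) : Prop :=
  (forall a b, phi (a * b) = phi (b * a))
  /\ (forall z, has_parity true z -> phi z = 0).

Definition transposition (i : 'I_n.-1) : 'S_n := tperm (pos0 i) (pos1 i).

(* The product of 'S_n composes permutations from left to right.  With the
   opposite convention w is replaced by w^-1 in T_w below, which only permutes
   the basis and fixes the index 1; the word defining w_nu is unaffected. *)
Definition word_perm (s : seq 'I_n.-1) : 'S_n :=
  (\prod_(i <- s) transposition i)%g.

Definition reduced_word (w : 'S_n) (s : seq 'I_n.-1) : Prop :=
  word_perm s = w /\ forall s', word_perm s' = w -> (size s <= size s')%N.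

Definition HC_Tw (w : 'S_n) : HC :=
  \prod_(i <- xget [::] [set s | reduced_word w s]) HC_T i.

Definition HC_Cpow (beta : {ffun 'I_n -> 'Z_2}) : HC :=
  \prod_(j < n) HC_C j ^+ beta j.

(* HC_X k is X_{k+1} *)
Fixpoint HC_X (k : nat) : HC :=
  if k is k'.+1 then
    if insub k' : option 'I_n.-1 is Some i then
      (HC_T i + eps *: (HC_C (pos0 i) * HC_C (pos1 i))) * HC_X k' * HC_T i
    else 0
  else 1.

Definition is_tau (tau : {scalar HC}) : Prop :=
  forall beta w,
    tau (HC_Cpow beta * HC_Tw w) = ((beta == 0) && (w == 1%g))%:R.

Definition t_form (tau : {scalar HC}) (h : HC) : R :=
  tau (h * \prod_(k < n) (1 + HC_X k)).

Definition odd_partition (nu : seq nat) : bool :=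
  [&& sorted geq nu, all odd nu & sumn nu == n].

Definition block_ends (nu : seq nat) : seq nat :=
  [seq sumn (take k nu) | k <- iota 1 (size nu).-1].

Definition w_odd (nu : seq nat) : 'S_n :=
  (\prod_(i < n.-1 | i.+1 \notin block_ends nu) transposition i)%g.

(* The value ((q ^+ 2 - 1) / 2) ^+ (n - l(nu)) is the one for the generators
   q *: T_i, which satisfy (x - q ^+ 2) * (x + 1) = 0.  For T_i, normalised by
   T_i ^+ 2 = eps *: T_i + 1, it becomes (eps / 2) ^+ (n - l(nu)). *)
Definition is_gimel (phi : {scalar HC}) : Prop :=
  is_trace phi /\
  forall nu, odd_partition nu ->
    phi (HC_Tw (w_odd nu)) = (eps / 2%:R) ^+ (n - size nu).

End HeckeClifford.

(* Main.v *)
Require Import Defs.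
From HB Require Import structures.
From mathcomp Require Import all_boot all_algebra all_fingroup.
From mathcomp Require Import boolp classical_sets zify.
From mathcomp.multinomials Require Import monalg.

(** Write H_k for the subalgebra generated by the first k Clifford generators
    and the first k - 1 of the T_i, all indices starting from 0.  Both forms
    are compared along the tower of the H_k, by means of the decomposition
    H_(k+1) = H_k + H_k C_k + H_k T_(k-1) H_k  ([layer_full]).

    The form.  The linear form tau vanishes on the complement
    H_k C_k + H_k T_(k-1) H_k of H_k ([tau_above]).  The Jucys-Murphy element
    X_k commutes with H_k ([X_comm_low]), is congruent to 1 modulo this
    complement, and C_k X_k belongs to it ([above_X]).  Together with the
    commutation rule of T_k and X_(k+1) ([T_X]), this yields for
    P_k = (1 + X_0) ... (1 + X_(k-1)) and a, b in H_k
<<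
      tau (a P_(k+1))           = 2 tau (a P_k),
      tau (a C_k P_(k+1))       = 0,
      tau (a T_(k-1) b P_(k+1)) = epsilon tau (a b P_k).
>>
    So the functionals tau (_ P_k) / 2^k are the restrictions to the H_k of a
    Markov functional with parameter z = epsilon / 2.

    The trace.  Let W be the product of some T_i with i >= k, in increasing
    order, and h in H_(k+1).  If h = a C_k, then the trace vanishes at h W
    because a either supercommutes with C_k W or makes h W odd
    ([trace_C_block]).  If h = a T_(k-1) b, then h W has the trace of
    b a (T_(k-1) W), where T_(k-1) W is again an increasing product and b a is
    in H_k.  Hence the trace is governed by its values at increasing products,
    the T_w for w a Coxeter element of a Young subgroup.  The values at odd
    partitions are given; parts of a composition are permuted by conjugation
    with powers of a Coxeter element ([trace_swap]), and an even part M is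
    eliminated through conjugation by Clifford generators, which expresses
    twice the value by the values where M is cut into two parts
    ([even_block]).  The value for a composition gam is thus
    z ^ (n - size gam) in all cases ([trace_blocks]), as it is for the Markov
    functional, and [trace_tau] carries out the comparison by induction on k.

    The form tau is known on the products C^beta T_w, where T_w is computed
    from an arbitrarily chosen reduced word of w.  Its values on other words
    are obtained from the staircase normal forms of the words in the simple
    transpositions: appending a letter to a normal word gives, up to braid
    relations, a longer normal word or undoes a last letter
    ([normal_word_step]).  It follows that every reduced word is equal to the
    normal word of its permutation by braid relations only
    ([reduced_word_normal]). *)

Set Implicit Arguments.
Unset Strict Implicit.
Unset Printing Implicit Defensive.

Import GRing.Theory.
Local Open Scope ring_scope.

(** * Presentation by generators and linear spans of words *)

Section Span.
Variables (R : comNzRingType) (A : algType R).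

(** The spanning sets that occur are infinite families of products, given by
    existential properties; hence the encoding by predicates. *)
Inductive Rspan (P : A -> Prop) : A -> Prop :=
| span0 : Rspan P 0
| spanD x y : Rspan P x -> Rspan P y -> Rspan P (x + y)
| spanZ c x : P x -> Rspan P (c *: x).

Lemma span_mem (P : A -> Prop) x : P x -> Rspan P x.
Proof. by move=> Px; rewrite -[x]scale1r; apply: spanZ. Qed.

Lemma spanZr (P : A -> Prop) c x : Rspan P x -> Rspan P (c *: x).
Proof.
elim=> [|{}x y _ IHx _ IHy|d {}x Px].
- by rewrite scaler0; apply: span0.
- by rewrite scalerDr; apply: spanD.
- by rewrite scalerA; apply: spanZ.
Qed.

Lemma spanN (P : A -> Prop) x : Rspan P x -> Rspan P (- x).
Proof. by rewrite -scaleN1r; apply: spanZr. Qed.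

Lemma spanB (P : A -> Prop) x y : Rspan P x -> Rspan P y -> Rspan P (x - y).
Proof. by move=> Px /spanN; apply: spanD. Qed.

Lemma span_sub (P Q : A -> Prop) x :
  (forall y, P y -> Rspan Q y) -> Rspan P x -> Rspan Q x.
Proof.
move=> PQ; elim=> [|{}x y _ IHx _ IHy|d {}x Px].
- exact: span0.
- exact: spanD.
- exact/spanZr/PQ.
Qed.

Lemma spanM (P Q S : A -> Prop) x y :
  (forall a b, P a -> Q b -> Rspan S (a * b)) ->
  Rspan P x -> Rspan Q y -> Rspan S (x * y).
Proof.
move=> PQ Px Qy; elim: Px => [|{}x z _ IHx _ IHz|d {}x Px].
- by rewrite mul0r; apply: span0.
- by rewrite mulrDl; apply: spanD.
rewrite -scalerAl; apply: spanZr.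
elim: Qy => [|{}y z _ IHy _ IHz|d' {}y Qy].
- by rewrite mulr0; apply: span0.
- by rewrite mulrDr; apply: spanD.
by rewrite -scalerAr; apply/spanZr/PQ.
Qed.

Lemma span_mulLR (P Q : A -> Prop) a x b :
  (forall y, P y -> Rspan Q (a * y * b)) -> Rspan P x -> Rspan Q (a * x * b).
Proof.
move=> PQ; elim=> [|{}x y _ IHx _ IHy|c {}x /PQ Px].
- by rewrite mulr0 mul0r; apply: span0.
- by rewrite mulrDr mulrDl; apply: spanD.
- by rewrite -scalerAr -scalerAl; apply: spanZr.
Qed.

Lemma span_mulR (P Q : A -> Prop) x b :
  (forall y, P y -> Rspan Q (y * b)) -> Rspan P x -> Rspan Q (x * b).
Proof.
move=> PQ Px; rewrite -[x]mul1r; apply: span_mulLR Px => y; rewrite mul1r;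
  exact: PQ.
Qed.

Lemma span_mulL (P Q : A -> Prop) a x :
  (forall y, P y -> Rspan Q (a * y)) -> Rspan P x -> Rspan Q (a * x).
Proof.
move=> PQ Px; rewrite -[a * x]mulr1; apply: span_mulLR Px => y; rewrite mulr1;
  exact: PQ.
Qed.

Lemma Rspan_linear (phi : {scalar A}) (P : A -> Prop) x :
  (forall y, P y -> phi y = 0) -> Rspan P x -> phi x = 0.
Proof.
move=> P0; elim=> [|{}x y _ IHx _ IHy|d {}x /P0 Px].
- exact: raddf0.
- by rewrite raddfD /= IHx IHy addr0.
- by rewrite linearZ /= Px mulr0.
Qed.

End Span.

(** The generators are indexed by all natural numbers. The relations that
    bear no range condition are those that survive when the generators out
    of range are replaced by 0. *)
Record presentation (R : comNzRingType) (e : R) (n : nat) (A : algType R)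
    (T C : nat -> A) : Prop := Presentation {
  presTT : forall i, (i < n.-1)%N -> T i * T i = 1 + e *: T i;
  presT_comm : forall i j, (i.+1 < j)%N || (j.+1 < i)%N -> T i * T j =
    T j * T i;
  presT_braid : forall i, T i * T i.+1 * T i = T i.+1 * T i * T i.+1;
  presCC : forall i, (i < n)%N -> C i * C i = 1;
  presC_anti : forall i j, i != j -> C i * C j = - (C j * C i);
  presTC0 : forall i, T i * C i = C i.+1 * T i;
  presTC1 : forall i, (i < n.-1)%N ->
    T i * C i.+1 = C i * T i - e *: (C i - C i.+1);
  presTC : forall i j, j != i -> j != i.+1 -> T i * C j = C j * T i
}.

Definition letter : Type := (nat + nat)%type.
Definition isC (x : letter) : bool := if x is inr _ then true else false.
Definition in_rank (m r : nat) (x : letter) : bool :=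
  match x with inl i => (i < m)%N | inr j => (j < r)%N end.

Section Words.
Variables (R : comNzRingType) (A : algType R) (T C : nat -> A).

Definition gen (x : letter) : A :=
  match x with inl i => T i | inr j => C j end.
Definition word (s : seq letter) : A := \prod_(x <- s) gen x.

Lemma word_nil : word [::] = 1.
Proof. exact: big_nil. Qed.
Lemma word_cons x s : word (x :: s) = gen x * word s.
Proof. exact: big_cons. Qed.
Lemma word_cat s t : word (s ++ t) = word s * word t.
Proof. exact: big_cat. Qed.
Lemma word1 x : word [:: x] = gen x.
Proof. exact: big_seq1. Qed.

(** [subalg k.-1 k] is the Hecke-Clifford algebra on the first [k] strands.
    The two ranks are independent because the evaluation of the form on
    products also involves words with few [T i] and all [C j]. *)
Definition subalg (m r : nat) : A -> Prop :=
  Rspan (fun y => exists2 s, all (in_rank m r) s & y = word s).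

End Words.

(** * Restriction to the subalgebra on one strand less *)

Section Decomposition.
Variables (R : comNzRingType) (e : R) (n : nat) (A : algType R).
Variables (T C : nat -> A).
Hypothesis HCpres : presentation e n T C.
Local Notation gen := (gen T C).
Local Notation word := (word T C).
Local Notation subalg := (subalg T C).
Let TT := presTT HCpres.
Let T_comm := presT_comm HCpres.
Let T_braid := presT_braid HCpres.
Let CC := presCC HCpres.
Let C_anti := presC_anti HCpres.
Let TC0 := presTC0 HCpres.
Let TC1 := presTC1 HCpres.
Let TC := presTC HCpres.

Lemma subalg_word m r s : all (in_rank m r) s -> subalg m r (word s).
Proof. by move=> hs; apply: span_mem; exists s. Qed.

Lemma subalg1 m r : subalg m r 1.
Proof. by rewrite -(word_nil T C); apply: subalg_word. Qed.

Lemma subalg_gen m r x : in_rank m r x -> subalg m r (gen x).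
Proof. by move=> hx; rewrite -word1; apply: subalg_word; rewrite /= hx. Qed.

Lemma subalg_T m r i : (i < m)%N -> subalg m r (T i).
Proof. exact: (@subalg_gen m r (inl i)). Qed.

Lemma subalg_C m r i : (i < r)%N -> subalg m r (C i).
Proof. exact: (@subalg_gen m r (inr i)). Qed.

Lemma subalgM m r a b : subalg m r a -> subalg m r b -> subalg m r (a * b).
Proof.
apply: spanM => _ _ [s hs ->] [t ht ->].
by rewrite -word_cat; apply: subalg_word; rewrite all_cat hs.
Qed.

Lemma subalg_mono m r m' r' a : (m <= m')%N -> (r <= r')%N ->
  subalg m r a -> subalg m' r' a.
Proof.
move=> hm hr; apply: span_sub => _ [s hs ->]; apply: subalg_word.
by apply: sub_all hs => -[i|i] /= hi; apply: leq_trans hi _.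
Qed.

Lemma subalg_comm m r y a : (forall x, in_rank m r x -> y * gen x =
    gen x * y) ->
  subalg m r a -> y * a = a * y.
Proof.
move=> hy; elim=> [|b c _ IHb _ IHc|c b [s hs ->]].
- by rewrite mulr0 mul0r.
- by rewrite mulrDr mulrDl IHb IHc.
rewrite -scalerAl -scalerAr; congr (_ *: _).
elim: s hs => [|x s IHs] /=; first by rewrite word_nil mulr1 mul1r.
by case/andP=> hx /IHs IH; rewrite word_cons mulrA hy // -!mulrA IH.
Qed.

Lemma T_subalg_comm k j a : (k <= j)%N -> subalg k.-1 k a -> T j * a = a * T j.
Proof.
move=> kj; apply: subalg_comm => -[i|i] /= hi; first by apply: T_comm; lia.
by apply: TC; lia.
Qed.

Lemma C_word j s : all (fun x => if x is inl i then (j != i) && (j != i.+1)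
                                 else if x is inr i then j != i else false) s ->
  word s * C j = (-1) ^+ count isC s *: (C j * word s).
Proof.
elim: s => [|x s IHs]; first by rewrite word_nil mulr1 mul1r scale1r.
rewrite [all _ _]/= => /andP[hx /IHs IH]; rewrite word_cons -mulrA IH.
case: x hx => i hi /=; rewrite -scalerAr !mulrA.
  by case/andP: hi => hi hi1; rewrite TC // add0n.
by rewrite (C_anti hi) exprS mulN1r scaleNr mulNr scalerN opprK.
Qed.

Lemma C_word_rank j k s : (k <= j)%N -> all (in_rank k.-1 k) s ->
  word s * C j = (-1) ^+ count isC s *: (C j * word s).
Proof.
move=> kj hs; apply: C_word; apply: sub_all hs => -[i|i] /= hi; lia.
Qed.

(** [b'] is the image of [b] under the parity automorphism; what is recorded
    is that it stays in the algebra. *)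
Lemma C_subalg k j b : (k <= j)%N -> subalg k.-1 k b ->
  exists2 b', subalg k.-1 k b' & b * C j = C j * b'.
Proof.
move=> kj; elim=> [|x y _ [x' hx Ex] _ [y' hy Ey]|c _ [s hs ->]].
- by exists 0; [apply: span0 | rewrite mulr0 mul0r].
- by exists (x' + y'); [apply: spanD | rewrite mulrDl mulrDr Ex Ey].
exists (c *: ((-1) ^+ count isC s *: word s)).
  by do 2!apply: spanZr; apply: subalg_word.
by rewrite -!scalerAr -scalerAl (C_word_rank kj hs).
Qed.

Lemma C_subalgr k j b : (k <= j)%N -> subalg k.-1 k b ->
  exists2 b', subalg k.-1 k b' & C j * b = b' * C j.
Proof.
move=> kj; elim=> [|x y _ [x' hx Ex] _ [y' hy Ey]|c _ [s hs ->]].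
- by exists 0; [apply: span0 | rewrite mulr0 mul0r].
- by exists (x' + y'); [apply: spanD | rewrite mulrDl mulrDr Ex Ey].
exists (c *: ((-1) ^+ count isC s *: word s)).
  by do 2!apply: spanZr; apply: subalg_word.
rewrite -!scalerAr -!scalerAl (C_word_rank kj hs) !scalerA -mulrA.
by rewrite -expr2 sqrr_sign mulr1.
Qed.

(** The three kinds of products that span the algebra on [k.+1] strands over
    the one on [k] strands. *)
Definition layer (k : nat) (y : A) : Prop :=
  [\/ exists2 s, all (in_rank k.-1 k) s & y = word s,
      exists2 s, all (in_rank k.-1 k) s & y = word s * C k |
      (0 < k)%N /\ exists s t, [/\ all (in_rank k.-1 k) s,
        all (in_rank k.-1 k) t
        & y = word s * T k.-1 * word t]].

Lemma layer_sub k a : subalg k.-1 k a -> Rspan (layer k) a.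
Proof. by apply: span_sub => y sy; apply: span_mem; constructor 1. Qed.

Lemma layer_C k a : subalg k.-1 k a -> Rspan (layer k) (a * C k).
Proof.
apply: span_mulR => _ [s hs ->].
by apply: span_mem; constructor 2; exists s.
Qed.

Lemma layer_T k a b : subalg k k.+1 a -> subalg k k.+1 b ->
  Rspan (layer k.+1) (a * T k * b).
Proof.
move=> ha hb; rewrite -mulrA; apply: (spanM _ ha (y := T k * b)); last first.
  apply: (span_mulL _ hb (Q := fun y => exists2 t,
    all (in_rank k k.+1) t & y = T k * word t)) => _ [t ht ->].
  by apply: span_mem; exists t.
move=> _ _ [s hs ->] [t ht ->]; apply: span_mem; constructor 3; split=> //.
by exists s, t; rewrite mulrA.
Qed.

(** The span is stable under right multiplication by each generator. The
    delicate product is a T_k b T_k with b on one strand less: b is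
    decomposed in turn, and the two factors T_k merge by the quadratic
    relation, by T_k C_k = C_(k+1) T_k or by the braid relation, according
    to the kind of b. *)
Lemma layer_full k x : (k < n)%N -> subalg k k.+1 x -> Rspan (layer k) x.
Proof.
elim: k x => [|k IHk] x kn.
  apply: span_sub => _ [s hs ->]; elim/last_ind: s hs => [|s y IHs].
    by move=> _; apply/layer_sub/subalg_word.
  rewrite all_rcons => /andP[hy /IHs]; rewrite -cats1 word_cat word1.
  apply: span_mulR => _ [[{IHs}s hs ->]|[{IHs}s hs ->]|[]] //.
    case: y hy => [|[|]] //= _.
    exact/layer_C/subalg_word.
  case: y hy => [|[|]] //= _.
  by rewrite -mulrA CC // mulr1; apply/layer_sub/subalg_word.
apply: span_sub => _ [s hs ->]; elim/last_ind: s hs => [|s y IHs].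
  by move=> _; apply/layer_sub/subalg_word.
rewrite all_rcons => /andP[hy /IHs]; rewrite -cats1 word_cat word1.
have TTk : T k * T k = 1 + e *: T k by rewrite TT //; lia.
have hCk : subalg k k.+1 (C k) by apply: subalg_C.
apply: span_mulR => _ [[{IHs}s /subalg_word hs ->]|[{IHs}s /subalg_word hs ->]|
  [_ [{IHs}s [t [/subalg_word hs ht ->]]]]];
  case: y hy => i /= hi.
- have [->|ik] := eqVneq i k.
    by rewrite -[_ * T k]mulr1; apply: layer_T (subalg1 _ _).
  by apply/layer_sub/subalgM => //; apply: subalg_T => /=; lia.
- have [->|ik] := eqVneq i k.+1; first exact: layer_C.
  by apply/layer_sub/subalgM => //; apply: subalg_C; lia.
- have [->|ik] := eqVneq i k; first by rewrite -mulrA -TC0 mulrA;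
  apply: layer_T.
  rewrite -mulrA -TC; try lia.
  by rewrite mulrA; apply/layer_C/subalgM => //; apply: subalg_T => /=; lia.
- have [->|ik] := eqVneq i k.+1.
    by rewrite -mulrA CC // mulr1; apply: layer_sub.
  rewrite -mulrA C_anti 1?eq_sym // mulrN mulrA;
    apply/spanN/layer_C/subalgM => //.
  by apply: subalg_C; lia.
- have [->|ik] := eqVneq i k; last first.
    rewrite -[_ * T i]mulrA; apply: layer_T => //.
    by apply: subalgM; [apply: subalg_word|apply: subalg_T => /=; lia].
  have kn' : (k < n)%N by lia.
  apply: span_mulLR (IHk _ kn' (subalg_word ht)) => _
    [[{ht}t ht ->]|[{ht}t ht ->]|[k0 [t1 [t2 [ht1 ht2 ->]]]]].
  + have hT := subalg_mono (leq_pred k) (leqnSn k) (subalg_word ht).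
    have /T_subalg_comm : subalg k.-1 k (word t) by apply: subalg_word.
    move=> /(_ _ (leqnn k)) Tt;
      rewrite -!mulrA -Tt (mulrA (T k)) TTk mulrDl mul1r.
    rewrite mulrDr -scalerAl -scalerAr; apply: spanD.
      exact/layer_sub/subalgM.
    by rewrite mulrA; apply/spanZr/layer_T.
  + have hT := subalg_mono (leq_pred k) (leqnSn k) (subalg_word ht).
    have /T_subalg_comm : subalg k.-1 k (word t) by apply: subalg_word.
    move=> /(_ _ (leqnn k)) Tt.
    have -> : word s * T k * (word t * C k) * T k =
        word s * word t * C k.+1 + e *: (word s * word t * T k * C k).
      rewrite -!mulrA (mulrA (T k)) Tt -!mulrA (mulrA (T k)) TC0 -mulrA TTk.
      by rewrite !mulrDr !mulr1 -!scalerAr.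
    apply: spanD; first exact/layer_C/subalgM.
    by apply/spanZr/layer_T => //; apply: subalgM.
  + case: k k0 {IHk ht t} hs kn TTk hCk hi kn' ht1 ht2 =>
    //= k _ hs kn _ _ _ _ ht1 ht2.
    have H1 := subalg_word ht1; have H2 := subalg_word ht2.
    have E1 := T_subalg_comm (leqnn k.+1) H1.
    have E2 := T_subalg_comm (leqnn k.+1) H2.
    have up a : subalg k k.+1 a -> subalg k.+1 k.+2 a by apply: subalg_mono;
      lia.
    have hT : subalg k.+1 k.+2 (T k) by apply: subalg_T.
    have -> : word s * T k.+1 * (word t1 * T k * word t2) * T k.+1 =
        word s * word t1 * T k * T k.+1 * (T k * word t2).
      rewrite -!mulrA -E2 (mulrA (T k.+1) (word t1)) E1 -!mulrA;
        do 2!congr (_ * _).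
      by rewrite !mulrA T_braid.
    by apply: layer_T; do ?apply: subalgM => //; apply: up.
have [->|ik] := eqVneq i k.+1; last first.
  rewrite -[_ * C i]mulrA; apply: layer_T => //.
  by apply: subalgM; [apply: subalg_word|apply: subalg_C; lia].
have /C_subalg : subalg k.+1.-1 k.+1 (word t) by apply: subalg_word.
case/(_ k.+1 (leqnn _)) => t' ht' Et; rewrite -mulrA Et mulrA -(mulrA _ (T k)).
rewrite TC1 ?mulrBr ?mulrBl; last lia.
apply: spanB; first by rewrite mulrA; apply: layer_T => //; apply: subalgM.
rewrite -scalerAr -scalerAl; apply: spanZr; rewrite mulrBr mulrBl.
apply: spanB; first by apply/layer_sub; do ?apply: subalgM.
have /C_subalgr : subalg k.+1.-1 k.+1 t' by [].
case/(_ k.+1 (leqnn _)) => t'' ht'' Et'; rewrite -mulrA Et' mulrA.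
exact/layer_C/subalgM.
Qed.
End Decomposition.

(** * Words in the simple transpositions and their normal forms *)

Section NormalForms.
Local Open Scope nat_scope.

(** The quadratic relation and its specialization at involutions are left
    out, so that equal words give equal products of the [T i] and of the
    simple transpositions alike. *)
Inductive braid_eq (m : nat) : seq nat -> seq nat -> Prop :=
| braid_eq_refl u : braid_eq m u u
| braid_eq_sym u v : braid_eq m u v -> braid_eq m v u
| braid_eq_trans u v w : braid_eq m u v -> braid_eq m v w -> braid_eq m u w
| braid_eq_cat u v u' v' : braid_eq m u u' -> braid_eq m v v' ->
    braid_eq m (u ++ v) (u' ++ v')
| braid_eq_comm i j : i.+1 < j -> braid_eq m [:: i; j] [:: j; i]
| braid_eq_braid i : i.+1 < m -> braid_eq m [:: i; i.+1; i] [:: i.+1; i; i.+1].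

Definition down (p l : nat) : seq nat := rev (iota p l).

(** A normal word on the letters below [k] is a concatenation of descending
    runs, the run of rank [j] being either empty or starting at [j]. The run
    of rank [k] goes down to [p], and [p = k.+1] makes it empty. *)
Inductive normal_word : nat -> seq nat -> Prop :=
| normal_word0 : normal_word 0 [::]
| normal_wordS k v p : normal_word k v -> p <= k.+1 ->
    normal_word k.+1 (v ++ down p (k.+1 - p)).

Lemma downS p l : down p l.+1 = (p + l) :: down p l.
Proof. by rewrite /down -addn1 iotaD rev_cat. Qed.

Lemma down_rcons p l : down p l.+1 = rcons (down p.+1 l) p.
Proof. by rewrite /down /= rev_cons. Qed.

Lemma braid_eq_catl m w u v : braid_eq m u v -> braid_eq m (w ++ u) (w ++ v).
Proof. by apply: braid_eq_cat; apply: braid_eq_refl. Qed.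

Lemma braid_eq_catr m w u v : braid_eq m u v -> braid_eq m (u ++ w) (v ++ w).
Proof. by move=> h; apply: braid_eq_cat => //; apply: braid_eq_refl. Qed.

Lemma braid_eq_cons m i u v : braid_eq m u v -> braid_eq m (i :: u) (i :: v).
Proof. exact: (@braid_eq_catl m [:: i]). Qed.

Lemma braid_eq_swap m i j w : i.+1 < j ->
    braid_eq m (j :: i :: w) (i :: j :: w).
Proof.
by move=> ij; apply: (@braid_eq_catr m w [:: j; i] [:: i; j]);
  apply/braid_eq_sym/braid_eq_comm.
Qed.

Lemma braid_eq_far m i u : all (fun x => (i.+1 < x) || (x.+1 < i)) u ->
  braid_eq m (rcons u i) (i :: u).
Proof.
elim: u => [|x u IHu] /=; first by move=> _; apply: braid_eq_refl.
move=> /andP[hx /IHu IH]; apply: braid_eq_trans (braid_eq_cons x IH) _.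
case/orP: hx => hx; first exact: braid_eq_swap.
exact/braid_eq_sym/braid_eq_swap.
Qed.

Lemma mem_down p l x : (x \in down p l) = (p <= x < p + l).
Proof. by rewrite mem_rev mem_iota. Qed.

(** In the middle of the descending run the braid relation turns [i; i - 1;
    i] into [i - 1; i; i - 1], and the other letters commute. *)
Lemma down_shift m p l i : p < i < p + l -> p + l <= m ->
  braid_eq m (rcons (down p l) i) (i.-1 :: down p l).
Proof.
elim: l => [|l IHl]; first lia.
move=> hi hm; rewrite downS rcons_cons.
have [il|il] := ltnP i (p + l).
  apply: braid_eq_trans (braid_eq_cons _ (IHl _ _)) _; [lia | lia |].
  by apply: braid_eq_swap; lia.
have {il}-> : i = (p + l) by lia.
case: l {IHl} hi hm => [|l] hi hm; first lia.
rewrite downS rcons_cons addnS /=.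
apply: (@braid_eq_trans _ _ ([:: (p + l).+1; p + l; (p + l).+1] ++ down p l)).
  do 2!apply: braid_eq_cons; apply: braid_eq_far; apply/allP => x.
  by rewrite mem_down; lia.
apply: (@braid_eq_catr _ _ _ [:: p + l; (p + l).+1; p + l]).
by apply/braid_eq_sym/braid_eq_braid; lia.
Qed.

(** [u'] is the normal form of [u] followed by [i], as a permutation. In the
    second alternative [i] cancels the last letter of a word equal to [u] by
    braid relations, and this is where the quadratic relation of the [T i]
    enters. *)
Definition step (m : nat) (u : seq nat) (i : nat) (u' : seq nat) : Prop :=
  size u' = (size u).+1 /\ braid_eq m (rcons u i) u' \/
  size u = (size u').+1 /\ braid_eq m u (rcons u' i).

Lemma step_cat m v d i j v' : braid_eq m (rcons d i) (j :: d) ->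
  step m v j v' -> step m (v ++ d) i (v' ++ d).
Proof.
move=> hd; have Ec w : (rcons w j) ++ d = w ++ j :: d by rewrite cat_rcons.
move=> [[s h]|[s h]]; [left|right]; rewrite !size_cat s; split=> //.
  rewrite -cats1 -catA cats1; apply: braid_eq_trans (braid_eq_catl v hd) _.
  by rewrite -Ec; apply: braid_eq_catr.
apply: braid_eq_trans (braid_eq_catr d h) _; rewrite Ec rcons_cat.
exact/braid_eq_catl/braid_eq_sym.
Qed.

(** The clause on [p'] says that a letter below [k] never erases the last
    run: permutations outside the subgroup that fixes the last point stay
    outside. *)
Lemma normal_word_step_last m k v p i : k.+1 <= m ->
  (forall j, j < k -> exists2 v', normal_word k v' & step m v j v') ->
  normal_word k v -> p <= k.+1 -> i <= k ->
  exists v' p', [/\ normal_word k v', p' <= k.+1, (i < k -> p <= k -> p' <= k) &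
    step m (v ++ down p (k.+1 - p)) i (v' ++ down p' (k.+1 - p'))].
Proof.
move=> km IH hv hp hi; have [ip|ip] := eqVneq i.+1 p.
  exists v, i; split=> //; try lia.
  left; rewrite -ip !size_cat !size_rev !size_iota; split; first lia.
  have -> : k.+1 - i = (k.+1 - i.+1).+1 by lia.
  by rewrite down_rcons rcons_cat; apply: braid_eq_refl.
have [Eip|ip'] := eqVneq i p.
  exists v, p.+1; rewrite Eip; split=> //; try lia.
  right; rewrite !size_cat !size_rev !size_iota; split; first lia.
  have -> : k.+1 - p = (k.+1 - p.+1).+1 by lia.
  by rewrite down_rcons rcons_cat; apply: braid_eq_refl.
have [ltip|ltpi] := ltnP i p.
  have [v' hv' st] := IH i ltac:(lia); exists v', p; split=> //.
  apply: step_cat st; apply: braid_eq_far; apply/allP => x.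
  by rewrite mem_down; lia.
have [v' hv' st] := IH i.-1 ltac:(lia); exists v', p; split=> //.
by apply: step_cat st; apply: down_shift; lia.
Qed.

Lemma normal_word_step m k u i : k <= m -> normal_word k u -> i < k ->
  exists2 u', normal_word k u' & step m u i u'.
Proof.
move=> km hu; elim: hu km i => {k u} // k v p hv IH hp km i hi.
have [||v' [p' [hv' hp' _ st]]] := @normal_word_step_last m k v p i km _ hv hp.
- by move=> j; apply: IH; lia.
- by [].
by exists (v' ++ down p' (k.+1 - p')) => //; apply: normal_wordS.
Qed.

Lemma normal_word_nil k : normal_word k [::].
Proof.
elim: k => [|k IHk]; first exact: normal_word0.
by have := normal_wordS IHk (leqnn k.+1); rewrite subnn.
Qed.

Lemma normal_word_mono k k' u : k <= k' -> normal_word k u -> normal_word k' u.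
Proof.
move=> kk' hu; rewrite -(subnKC kk'); elim: (k' - k) => [|d IHd];
  first by rewrite addn0.
by have := normal_wordS IHd (leqnn (k + d).+1); rewrite subnn cats0 addnS.
Qed.

Lemma normal_word_lt k u : normal_word k u -> all (ltn^~ k) u.
Proof.
elim=> {k u} // k v p hv IH hp; rewrite all_cat; apply/andP; split.
  by apply: sub_all IH => x /=; lia.
by apply/allP => x; rewrite mem_down /=; lia.
Qed.

Definition swap (x i : nat) : nat :=
  if x == i then i.+1 else if x == i.+1 then i else x.
(** The permutation given by a word, as a map on all natural numbers. *)
Definition walk (u : seq nat) (x : nat) : nat := foldl swap x u.

Lemma swapK i : involutive (swap^~ i).
Proof. by move=> x; rewrite /swap; do ![case: eqP]; lia. Qed.

Lemma walk_cat u v x : walk (u ++ v) x = walk v (walk u x).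
Proof. exact: foldl_cat. Qed.

Lemma walk_inj u : injective (walk u).
Proof.
elim: u => [|i u IHu] x y //= /IHu; exact: (can_inj (swapK i)).
Qed.

Lemma walk_out u k x : all (ltn^~ k) u -> k < x -> walk u x = x.
Proof.
move=> + hx; elim: u => //= i u IHu /andP[hi /IHu]; rewrite /swap.
by do 2!(case: eqP => ?; first lia).
Qed.

Lemma walk_down p l : walk (down p l) (p + l) = p.
Proof.
elim: l => [|l IHl]; first by rewrite addn0.
rewrite downS /=; have -> : swap (p + l.+1) (p + l) = p + l.
  by rewrite /swap; do ![case: eqP]; lia.
exact: IHl.
Qed.

Lemma walk_rcons u i x : walk (rcons u i) x = swap (walk u x) i.
Proof. by rewrite -cats1 walk_cat. Qed.

Lemma braid_eq_walk m u v : braid_eq m u v -> walk u =1 walk v.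
Proof.
elim=> {u v} [u|u v _ IH|u v w _ IHu _ IHv|u v u' v' _ IHu _ IHv|i j ij|i _] x
  //.
- by rewrite IHu.
- by rewrite !walk_cat IHu IHv.
- by rewrite /= /swap; do ![case: eqP]; lia.
- by rewrite /= /swap; do ![case: eqP]; lia.
Qed.

Lemma step_walk m u i u' : step m u i u' -> walk (rcons u i) =1 walk u'.
Proof.
move=> [[_ /braid_eq_walk //]|[_ /braid_eq_walk E]] x.
by rewrite walk_rcons E walk_rcons swapK.
Qed.

(** Appending a letter changes the length of the normal form by one, so a
    word is at least as long as its normal form, and when the lengths agree
    no cancellation has taken place. This is how the minimality of a reduced
    word is exploited. *)
Lemma word_normal_form m k s : k <= m -> all (ltn^~ k) s ->
  exists u, [/\ normal_word k u, walk s =1 walk u, size u <= size s &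
    size u = size s -> braid_eq m s u].
Proof.
move=> km; elim/last_ind: s => [|s i IHs].
  by move=> _; exists [::]; split=> // [|_];
    [apply: normal_word_nil | apply: braid_eq_refl].
rewrite all_rcons => /andP[hi /IHs[u [hu au su eu]]].
have [u' hu' st] := normal_word_step km hu hi; exists u'; rewrite size_rcons;
  split=> //.
- by move=> x; rewrite -(step_walk st) !walk_rcons au.
- by case: st => -[]; lia.
case: st => -[s1 h] s2; last lia.
by apply: braid_eq_trans h; rewrite -!cats1; apply/braid_eq_catr/eu; lia.
Qed.

(** The runs below the last one fix the point [k.+1], so its image reveals
    where the last run ends; that run can then be cancelled. *)
Lemma normal_word_inj k u v : normal_word k u -> normal_word k v ->
    walk u =1 walk v -> u = v.
Proof.
move=> hu; elim: hu v => {k u} [|k u p hu IHu hp] w hw; inversion hw => //;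
  subst.
rename v into v', H0 into hv, p0 into p', H1 into hp'.
move=> E; have /= := E k.+1.
rewrite !walk_cat (walk_out (normal_word_lt hu)) // (walk_out (normal_word_lt
  hv)) //.
have a r : r <= k.+1 -> walk (down r (k.+1 - r)) k.+1 = r.
  by move=> hr; rewrite -{2}(subnKC hr) walk_down.
rewrite (a p hp) (a p' hp') => pp; rewrite pp; congr (_ ++ _).
by apply: IHu => // x; have := E x; rewrite !walk_cat pp; apply: walk_inj.
Qed.

(** All runs of such a word are empty or of length one. *)
Lemma normal_word_filter m (P : pred nat) :
  normal_word m [seq i <- iota 0 m | P i].
Proof.
elim: m => [|m IHm]; first exact: normal_word0.
rewrite -addn1 iotaD filter_cat /= add0n addn1; case: (P m).
  by have := normal_wordS IHm (leqnSn m); rewrite subSnn /down.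
by have := normal_wordS IHm (leqnn m.+1); rewrite subnn.
Qed.

End NormalForms.

(** * Vanishing of the form outside a smaller algebra *)

Section CanonicalForm.
Variables (R : comNzRingType) (e : R) (n : nat) (A : algType R).
Variables (T C : nat -> A).
Hypothesis HCpres : presentation e n T C.
Local Notation word := (word T C).
Local Notation subalg := (subalg T C).
Let TT := presTT HCpres.
Let T_comm := presT_comm HCpres.
Let T_braid := presT_braid HCpres.
Let CC := presCC HCpres.
Let C_anti := presC_anti HCpres.
Let TC0 := presTC0 HCpres.
Let TC1 := presTC1 HCpres.
Let TC := presTC HCpres.

Definition Tword (u : seq nat) : A := \prod_(i <- u) T i.
Definition Cword (c : seq nat) : A := \prod_(i <- c) C i.
Definition Cpow (f : nat -> bool) : A := \prod_(i <- iota 0 n) C i ^+ f i.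

Lemma Tword_cons i u : Tword (i :: u) = T i * Tword u.
Proof. exact: big_cons. Qed.
Lemma Tword_cat u v : Tword (u ++ v) = Tword u * Tword v.
Proof. exact: big_cat. Qed.
Lemma Tword_nil : Tword [::] = 1.
Proof. exact: big_nil. Qed.
Lemma Tword1 i : Tword [:: i] = T i.
Proof. exact: big_seq1. Qed.
Lemma Tword_rcons u i : Tword (rcons u i) = Tword u * T i.
Proof. by rewrite -cats1 Tword_cat Tword1. Qed.
Lemma Cword_cons i u : Cword (i :: u) = C i * Cword u.
Proof. exact: big_cons. Qed.
Lemma Cword_nil : Cword [::] = 1.
Proof. exact: big_nil. Qed.

Lemma braid_eq_Tword m u v : braid_eq m u v -> Tword u = Tword v.
Proof.
elim=> {u v} // [u v w _ -> _ -> //|u v u' v' _ Eu _ Ev|i j ij|i _].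
- by rewrite !Tword_cat Eu Ev.
- by rewrite !Tword_cons Tword_nil !mulr1 T_comm // ij.
- by rewrite !Tword_cons Tword_nil !mulr1 !mulrA T_braid.
Qed.

Lemma step_Tword m u i u' : (i < n.-1)%N -> step m u i u' ->
  exists c, Tword u * T i = Tword u' + c *: Tword u.
Proof.
move=> hi [[_ /braid_eq_Tword h]|[_ /braid_eq_Tword h]].
  by exists 0; rewrite scale0r addr0 -h Tword_rcons.
exists e; rewrite h Tword_rcons -mulrA TT // mulrDr mulr1.
by rewrite -scalerAr.
Qed.

Lemma Tword_normal k t : (k <= n.-1)%N -> all (ltn^~ k) t ->
  Rspan (fun y => exists2 u, normal_word k u & y = Tword u) (Tword t).
Proof.
move=> kn; elim/last_ind: t => [|t i IHt].
  by move=> _; apply: span_mem; exists [::] => //; apply: normal_word_nil.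
rewrite all_rcons Tword_rcons => /andP[hi /IHt].
apply: span_mulR => _ [u hu ->].
have [u' hu' /step_Tword[|c ->]] := normal_word_step kn hu hi;
  first by move: hi => /=; lia.
by apply: spanD; [apply: span_mem; exists u' | apply: spanZ; exists u].
Qed.

(** Since the last run of [v] followed by [k] is not empty and the letters
    below [k] cannot erase it, the empty word does not occur. *)
Lemma Tword_normal_last k v t : (k < n.-1)%N -> normal_word k v ->
    all (ltn^~ k) t ->
  Rspan (fun y => exists2 u, normal_word k.+1 u /\ u != [::] & y = Tword u)
    (Tword v * T k * Tword t).
Proof.
move=> kn hv ht.
have : Rspan (fun y => exists v' p, [/\ normal_word k v', (p <= k)%N &
    y = Tword (v' ++ down p (k.+1 - p))]) (Tword v * T k * Tword t).
  elim/last_ind: t ht => [|t i IHt].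
    rewrite Tword_nil mulr1 => _; apply: span_mem; exists v, k; split=> //.
    by rewrite subSnn /down /= Tword_cat Tword1.
  rewrite all_rcons Tword_rcons mulrA => /andP[hi /IHt].
  apply: span_mulR => _ [v1 [p [hv1 hp ->]]].
  have /= hi' : (i < k)%N := hi.
  have st j : (j < k)%N -> exists2 v', normal_word k v' & step n.-1 v1 j v'.
    by apply: normal_word_step hv1; lia.
  have := normal_word_step_last (i := i) kn st hv1 (leqW hp) (ltnW hi').
  case=> v' [p' [hv' hp' hpp /step_Tword[|c ->]]]; first lia.
  apply: spanD; last by apply: spanZ; exists v1, p.
  by apply: span_mem; exists v', p'; split=> //; apply: hpp.
apply: span_sub => _ [v' [p [hv' hp ->]]]; apply: span_mem.
exists (v' ++ down p (k.+1 - p)) => //; split;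
  first by apply: normal_wordS => //; lia.
by rewrite -size_eq0 size_cat size_rev size_iota; lia.
Qed.

(** The lower-order terms of the relation for T_i C_(i+1) lose the factor
    T_i. *)
Lemma T_Cword m r i c : (i < m)%N -> (m < r)%N -> (r <= n)%N ->
    all (ltn^~ r) c ->
  Rspan (fun y => exists2 c', all (ltn^~ r) c' &
    y = Cword c' \/ y = Cword c' * T i)
    (T i * Cword c).
Proof.
move=> im mr rn.
have hC j x : (j < r)%N ->
    Rspan (fun y => exists2 c', all (ltn^~ r) c' & y = Cword c' \/ y =
      Cword c' * T i) x ->
    Rspan (fun y => exists2 c', all (ltn^~ r) c' & y = Cword c' \/ y =
      Cword c' * T i)
      (C j * x).
  move=> jr; apply: span_mulL => y [c' hc' E]; apply: span_mem.
  exists (j :: c'); first by rewrite /= jr.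
  by rewrite Cword_cons -mulrA; case: E => ->; [left|right].
elim: c => [|j c IHc].
  by rewrite Cword_nil mulr1 => _; apply: span_mem; exists [::] => //; right;
    rewrite Cword_nil mul1r.
rewrite Cword_cons mulrA => /= /andP[hj hc]; have IH := IHc hc.
have hc0 : Rspan (fun y => exists2 c', all (ltn^~ r) c' & y = Cword c' \/ y =
  Cword c' * T i) (Cword c).
  by apply: span_mem; exists c => //; left.
have [->|ji] := eqVneq j i; first by rewrite TC0 -mulrA; apply: hC => //; lia.
have [->|ji1] := eqVneq j i.+1; last by rewrite TC // -mulrA; apply: hC.
rewrite TC1; last lia.
rewrite mulrBl -mulrA -scalerAl mulrBl.
apply: spanB; first by apply: hC => //; lia.
by apply/spanZr/spanB; apply: hC => //; lia.
Qed.

Lemma subalg_CT m r a : (m < r)%N -> (r <= n)%N -> subalg m r a ->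
  Rspan (fun y => exists c t, [/\ all (ltn^~ r) c, all (ltn^~ m) t &
    y = Cword c * Tword t]) a.
Proof.
move=> mr rn; apply: span_sub => _ [s hs ->].
elim: s hs => [|x s IHs] /=.
  by move=> _; apply: span_mem; exists [::], [::];
    rewrite Cword_nil Tword_nil mulr1 word_nil.
move=> /andP[hx /IHs]; rewrite word_cons; apply: span_mulL =>
  _ [c [t [hc ht ->]]].
case: x hx => i /= hi; last first.
  apply: span_mem; exists (i :: c), t; split=> //; first by rewrite /= hi.
  by rewrite Cword_cons mulrA.
rewrite mulrA; apply: span_mulR (T_Cword hi mr rn hc) => _ [c' hc' [->|->]].
  by apply: span_mem; exists c', t.
apply: span_mem; exists c', (i :: t); split=> //; first by rewrite /= hi.
by rewrite Tword_cons mulrA.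
Qed.

Lemma subalg_normal m r a : (m < r)%N -> (r <= n)%N -> subalg m r a ->
  Rspan (fun y => exists c u, [/\ all (ltn^~ r) c, normal_word m u & y =
    Cword c * Tword u]) a.
Proof.
move=> mr rn /(subalg_CT mr rn); apply: span_sub => _ [c [t [hc ht ->]]].
have mn : (m <= n.-1)%N by lia.
apply: span_mulL (Tword_normal mn ht) => _ [u hu ->].
by apply: span_mem; exists c, u.
Qed.

(** Up to a sign, [C j] can be moved to its place in the product, where it
    toggles the exponent. *)
Lemma C_prod j r (f : nat -> bool) : (j < n)%N -> uniq r ->
  exists b, C j * (\prod_(i <- r) C i ^+ f i) = (-1) ^+ b *:
    (if j \in r then \prod_(i <- r) C i ^+ (f i (+) (i == j))
     else (\prod_(i <- r) C i ^+ f i) * C j).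
Proof.
move=> jn; elim: r => [|i r IHr] /=.
  by move=> _; exists 0%N; rewrite scale1r !big_nil mulr1 mul1r.
case/andP=> ir /IHr[b Eb]; rewrite !big_cons in_cons (eq_sym j i).
have [Eij|ij] /= := eqVneq i j; last first.
  have [b' Eb'] : exists b', C j * C i ^+ f i =
    (-1) ^+ b' *: (C i ^+ f i * C j).
    case: (f i); last by exists 0%N; rewrite scale1r expr0 mulr1 mul1r.
    by exists 1%N; rewrite expr1 scaleN1r C_anti // eq_sym.
  exists (b' + b)%N; rewrite mulrA Eb' -scalerAl -(mulrA _ (C j)) Eb exprD
    -scalerA -scalerAr.
  by case: ifP => _; rewrite ?addbF // !mulrA.
exists 0%N; rewrite scale1r addbT mulrA; congr (_ * _).
  by rewrite Eij; case: (f j) => /=; rewrite ?mulr1 ?CC.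
apply: eq_big_seq => x xr; case: eqP => [Ex|_]; last by rewrite addbF.
by rewrite Eij -Ex xr in ir.
Qed.

Lemma Cword_Cpow c : all (ltn^~ n) c ->
  exists b, Cword c = (-1) ^+ b *: Cpow (fun i => odd (count_mem i c)).
Proof.
elim: c => [|j c IHc] /=.
  move=> _; exists 0%N; rewrite scale1r Cword_nil /Cpow big1_seq //.
case/andP=> jn /IHc[b Eb].
have [b' Eb'] := C_prod (fun i => odd (count_mem i c)) jn (iota_uniq 0 n).
exists (b + b')%N; rewrite Cword_cons Eb -scalerAr Eb' mem_iota /= add0n jn.
rewrite scalerA -exprD; congr (_ *: _); apply: eq_bigr => i _.
by rewrite addbC oddD eq_sym oddb.
Qed.

Variable tau : {scalar A}.
Hypothesis tauP : forall f u, normal_word n.-1 u ->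
  tau (Cpow f * Tword u) = (all (fun i => ~~ f i) (iota 0 n) && (u == [::]))%:R.

Lemma tau1 : tau 1 = 1.
Proof.
have := tauP (fun=> false) (normal_word_nil n.-1).
rewrite eqxx Tword_nil mulr1 /Cpow big1_seq // => ->.
by rewrite (_ : all _ _) //; apply/allP.
Qed.

Lemma tau_CT c u : all (ltn^~ n) c -> normal_word n.-1 u ->
  u != [::] \/ (exists2 i, (i < n)%N & odd (count_mem i c)) ->
  tau (Cword c * Tword u) = 0.
Proof.
move=> hc hu H; have [b ->] := Cword_Cpow hc.
rewrite -scalerAl linearZ /= tauP //.
case: H => [/negPf->|[i hi oi]]; first by rewrite andbF mulr0.
rewrite (_ : all _ _ = false) ?mulr0 //; apply/negbTE/allPn; exists i => /=.
  by rewrite mem_iota.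
by rewrite oi.
Qed.

(** A bimodule over the algebra on [k] strands that completes it to the
    algebra on [k.+1] strands. *)
Definition above k : A -> Prop := Rspan (fun y =>
  (exists2 a, subalg k.-1 k a & y = a * C k) \/
  ((0 < k)%N /\ exists a b, [/\ subalg k.-1 k a, subalg k.-1 k b &
     y = a * T k.-1 * b])).

(** With all [C j] moved to the left, a C_k becomes a combination of
    products with an odd power of C_k. In a T_(k-1) b, the factor T_(k-1)
    passes the [C j] of b without lower-order terms and then persists in the
    last run of the normal words. *)
Lemma tau_above k y : (k < n)%N -> above k y -> tau y = 0.
Proof.
move=> kn; apply: Rspan_linear => {y} _ [[a ha ->]|[k0 [a [b [ha hb ->]]]]].
  have [a' ha' ->] := C_subalg HCpres (leqnn k) ha.
  have [k0|k0] := posnP k.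
    rewrite {}k0 in ha ha' kn *.
    have {}ha' : Rspan (fun y => y = 1) a'.
      apply: span_sub ha' => _ [[|[i|i] s] //= hs ->].
      by apply: span_mem; rewrite word_nil.
    apply: (Rspan_linear (P := fun y => y = C 0)).
      move=> _ ->; have := @tau_CT [:: 0%N] [::];
        rewrite Cword_cons Cword_nil Tword_nil !mulr1.
      by apply; [rewrite /= kn | apply: normal_word_nil | right; exists 0%N].
    by apply: span_mulL ha' => _ ->; apply: span_mem; rewrite mulr1.
  have hk : (k.-1 < k)%N by lia.
  apply: (Rspan_linear (P := fun y => exists c u, [/\ all (ltn^~ k) c,
    normal_word k.-1 u &
    y = Cword (k :: c) * Tword u])); last first.
    apply: span_mulL (subalg_normal hk (ltnW kn) ha') => _ [c [u [hc hu ->]]].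
    by apply: span_mem; exists c, u; rewrite Cword_cons mulrA.
  move=> _ [c [u [hc hu ->]]]; apply: tau_CT.
  - by rewrite /= kn; apply: sub_all hc => i /=; lia.
  - by apply: normal_word_mono hu; lia.
  right; exists k => //=; rewrite eqxx (_ : count _ _ = 0%N) //.
  apply/eqP; rewrite -leqn0 leqNgt -has_count; apply/hasPn => i /(allP hc) /=;
    lia.
case: k k0 kn ha hb => // k _ kn /= ha hb.
have kn1 : (k.+1 <= n)%N by lia.
have hb' := subalg_CT (ltnSn k) kn1 hb.
apply: (Rspan_linear (P := fun y => exists c u, [/\ all (ltn^~ n) c,
  normal_word k.+1 u, u != [::] & y = Cword c * Tword u])).
  move=> _ [c [u [hc hu u0 ->]]]; apply: tau_CT => //; last by left.
  by apply: normal_word_mono hu; lia.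
apply: span_mulL hb' => _ [c [t [hc ht ->]]].
have [c' hc' Ec] : exists2 c', all (ltn^~ n) c' & T k * Cword c =
  Cword c' * T k.
  elim: c hc => [|j c IHc] /=.
    by exists [::]; rewrite // Cword_nil mulr1 mul1r.
  case/andP=> hj /IHc[c' hc' Ec']; have [jk|jk] := eqVneq j k.
    exists (k.+1 :: c'); first by rewrite /= kn.
    by rewrite !Cword_cons jk mulrA TC0 -!mulrA Ec'.
  exists (j :: c'); first by rewrite /= hc' andbT; lia.
  by rewrite !Cword_cons mulrA TC -?mulrA ?Ec' //; lia.
rewrite -mulrA (mulrA (T k)) Ec !mulrA.
have hac : subalg k n (a * Cword c').
  apply: subalgM; first by apply: subalg_mono ha; lia.
  elim: c' hc' {Ec} => [|j c' IHc] /=; first by rewrite Cword_nil => _;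
    apply: subalg1.
  by case/andP=> hj /IHc h; rewrite Cword_cons; apply: subalgM => //;
    apply: subalg_C.
have kn2 : (k < n)%N by lia.
rewrite -mulrA; apply: span_mulR (subalg_normal kn2 (leqnn n) hac) =>
  _ [c1 [v [hc1 hv ->]]].
have kn3 : (k < n.-1)%N by lia.
rewrite -!mulrA (mulrA (Tword v)).
apply: span_mulL (Tword_normal_last kn3 hv ht) => _ [u [hu u0] ->].
by apply: span_mem; exists c1, u.
Qed.
End CanonicalForm.

(** * The Jucys-Murphy elements *)

Section JucysMurphy.
Variables (R : comNzRingType) (e : R) (n : nat) (A : algType R).
Variables (T C : nat -> A).
Hypothesis HCpres : presentation e n T C.
Local Notation subalg := (subalg T C).
Local Notation above := (above T C).
Let TT := presTT HCpres.
Let T_comm := presT_comm HCpres.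
Let T_braid := presT_braid HCpres.
Let CC := presCC HCpres.
Let C_anti := presC_anti HCpres.
Let TC0 := presTC0 HCpres.
Let TC1 := presTC1 HCpres.
Let TC := presTC HCpres.

Fixpoint jucys_murphy (k : nat) : A :=
  if k is k'.+1 then
    (T k' + e *: (C k' * C k'.+1)) * jucys_murphy k' * T k'
  else 1.
Local Notation X := jucys_murphy.

Lemma X_subalg k : subalg k k.+1 (X k).
Proof.
elim: k => [|k IHk] /=; first exact: subalg1.
have up a : subalg k k.+1 a -> subalg k.+1 k.+2 a by apply: subalg_mono; lia.
have hT : subalg k.+1 k.+2 (T k) by apply: subalg_T.
apply: subalgM => //; apply: subalgM; last exact: up.
by apply: spanD => //; apply/spanZr/subalgM; apply: subalg_C; lia.
Qed.

Lemma C2_comm i j k : k != i -> k != j -> C k * (C i * C j) = C i * C j * C k.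
Proof.
move=> ki kj; rewrite mulrA (C_anti ki) mulNr -(mulrA _ (C k)) (C_anti kj).
by rewrite mulrN opprK mulrA.
Qed.

Lemma X_commS y k : y * T k = T k * y ->
  y * (C k * C k.+1) = C k * C k.+1 * y -> y * X k = X k * y ->
  y * X k.+1 = X k.+1 * y.
Proof.
move=> hT hC IH /=.
rewrite !mulrA mulrDr hT // -scalerAr hC // scalerAl -mulrDl.
by rewrite -!mulrA -hT // (mulrA y) IH !mulrA.
Qed.

Lemma X_comm y k : (forall i, (i < k)%N -> y * T i = T i * y) ->
  (forall i, (i < k)%N -> y * (C i * C i.+1) = C i * C i.+1 * y) ->
  y * X k = X k * y.
Proof.
elim: k => [|k IHk] hT hC; first by rewrite mulr1 mul1r.
by apply: X_commS; [apply: hT | apply: hC | apply: IHk => i hi;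
  [apply: hT | apply: hC]; lia].
Qed.

Lemma X_comm_C k j : (k < j)%N -> C j * X k = X k * C j.
Proof.
move=> kj; apply: X_comm => i hi; first by rewrite TC //; lia.
by apply: C2_comm; lia.
Qed.

Lemma T_C2_comm i j : (i.+1 < j)%N || (j.+1 < i)%N ->
  T i * (C j * C j.+1) = C j * C j.+1 * T i.
Proof.
move=> ij; have E1 : T i * C j = C j * T i by apply: TC; lia.
have E2 : T i * C j.+1 = C j.+1 * T i by apply: TC; lia.
by rewrite mulrA E1 -mulrA E2 mulrA.
Qed.

Lemma X_comm_T k j : (k < j)%N -> T j * X k = X k * T j.
Proof.
move=> kj; apply: X_comm => i hi; first by apply: T_comm; lia.
by apply: T_C2_comm; lia.
Qed.

(** The product of the two outer factors of X_(k+2) carries T_(k+1) to T_k.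
    After expansion, the terms in the squares of [e] cancel because the [C
    j] anticommute. *)
Lemma intertwine k : (k.+2 < n)%N ->
  T k * ((T k.+1 + e *: (C k.+1 * C k.+2)) * (T k + e *: (C k * C k.+1))) =
  (T k.+1 + e *: (C k.+1 * C k.+2)) * (T k + e *: (C k * C k.+1)) * T k.+1.
Proof.
move=> kn.
pose a := T k; pose b := T k.+1; pose x := C k; pose y := C k.+1;
  pose z := C k.+2.
have aa : a * a = 1 + e *: a by apply: TT; lia.
have bb : b * b = 1 + e *: b by apply: TT; lia.
have aba : a * b * a = b * a * b by apply: T_braid.
have ax : a * x = y * a by apply: TC0.
have ay : a * y = x * a - e *: (x - y) by apply: TC1; lia.
have az : a * z = z * a by apply: TC; lia.
have bx : b * x = x * b by apply: TC; lia.
have b_y : b * y = z * b by apply: TC0.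
have zy : z * y = - (y * z) by apply: C_anti; lia.
have zx : z * x = - (x * z) by apply: C_anti; lia.
have yzxy : y * z * (x * y) = z * x.
  have yy : y * y = 1 by apply: CC; lia.
  have Ey : y * (z * x) = z * x * y by apply: C2_comm; lia.
  by rewrite mulrA -(mulrA y) Ey -mulrA yy mulr1.
have E1 : a * (b * (x * y)) = y * z * (a * b).
  rewrite (mulrA b) bx -(mulrA x) b_y !mulrA ax -!mulrA; congr (_ * _).
  by rewrite !mulrA az.
have E2 : a * (y * z * a) = x * z + e *: (y * z * a).
  rewrite !mulrA ay mulrBl mulrBl -scalerAl mulrBl -scalerAl mulrBl.
  rewrite -(mulrA x a z) az !mulrA -(mulrA (x * z)) aa mulrDr mulr1 -scalerAr.
  by rewrite scalerBr opprB -addrA; congr (_ + _); rewrite addrC subrK.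
have E3 : a * (y * z * (x * y)) = - (y * z * a).
  by rewrite yzxy mulrA az -mulrA ax mulrA zy mulNr.
have E4 : b * (x * y * b) = x * z + e *: (x * z * b).
  by rewrite !mulrA bx -(mulrA x) b_y mulrA -mulrA bb mulrDr mulr1 -scalerAr.
have E5 : y * z * (x * y) * b = - (x * z * b) by rewrite yzxy zx mulNr.
have L : a * ((b + e *: (y * z)) * (a + e *: (x * y))) =
    a * b * a + e *: (y * z * (a * b)) + e *: (x * z).
  rewrite mulrDl !mulrDr -!scalerAl -!scalerAr E1 E2 E3 !mulrA -!addrA.
  by rewrite scalerDr scalerN scalerN; congr (_ + (_ + _));
    rewrite -addrA subrr addr0.
have Rr : (b + e *: (y * z)) * (a + e *: (x * y)) * b =
    b * a * b + e *: (y * z * (a * b)) + e *: (x * z).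
  rewrite mulrDl !mulrDr !mulrDl -!scalerAl -!scalerAr -!scalerAl.
  rewrite -(mulrA b (x * y) b) E4 E5 -!mulrA !scalerDr !scalerN -!addrA;
    congr (_ + _).
  by rewrite [_ + (_ - _)]addrC subrK addrC.
by rewrite -/a -/b -/x -/y -/z L Rr aba.
Qed.

Lemma X_comm_T_pred k : (k.+2 < n)%N -> X k.+2 * T k = T k * X k.+2.
Proof.
move=> kn /=; set B := (_ + _); set D := (X in B * (X * _ * _) * _).
rewrite -/D.
have I : T k * (B * D) = B * D * T k.+1 by apply: intertwine.
rewrite !mulrA -(mulrA _ B) I -!mulrA; do 2!congr (_ * _).
rewrite (mulrA (T k.+1) (X k)) X_comm_T // -!mulrA; congr (_ * _).
by rewrite !mulrA T_braid.
Qed.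

Lemma X_comm_C_pred k : (k.+1 < n)%N -> X k.+1 * C k = C k * X k.+1.
Proof.
move=> kn /=.
rewrite -mulrA TC0 -mulrA (mulrA (X k)) -X_comm_C // !mulrA; do 2!congr (_ * _).
rewrite mulrDl mulrDr TC1; last lia.
rewrite -scalerAl -mulrA CC // mulr1 -scalerAr mulrA CC ?mul1r; last lia.
by rewrite scalerBr opprB -addrA subrK.
Qed.

Lemma X_comm_low k x : (k < n)%N -> subalg k.-1 k x -> X k * x = x * X k.
Proof.
move=> kn; apply: subalg_comm => y hy; apply/esym.
elim: k kn hy => [|k IHk] kn; first by case: y.
case: y IHk => i /= IHk hi.
  case: k IHk kn hi => // k IHk kn hi; have [->|ki] := eqVneq i k.
    by rewrite -X_comm_T_pred.
  apply: X_commS; [apply: T_comm; lia | apply: T_C2_comm; lia |].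
  by apply: IHk => /=; lia.
have [->|ik] := eqVneq i k; first by rewrite -X_comm_C_pred.
apply: X_commS; [by rewrite TC // eq_sym; lia | apply: C2_comm; lia |].
by apply: IHk; lia.
Qed.

Lemma aboveM k a y b : subalg k.-1 k a -> subalg k.-1 k b -> above k y ->
  above k (a * y * b).
Proof.
move=> ha hb; apply: span_mulLR => _ [[c hc ->]|[k0 [c [d [hc hd ->]]]]].
  have [b' hb' E] := C_subalgr HCpres (leqnn k) hb.
  apply: span_mem; left; exists (a * c * b'); first by do ?apply: subalgM.
  by rewrite -!mulrA E.
apply: span_mem; right; split=> //; exists (a * c), (d * b).
by split; [apply: subalgM | apply: subalgM | rewrite !mulrA].
Qed.

(** T_k y T_k is in turn reduced by T_k C_k = C_(k+1) T_k or by the braid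
    relation, according to the kind of y. *)
Lemma above_TT k y : (k.+1 < n)%N -> above k y -> above k.+1 (T k * y * T k).
Proof.
move=> kn; have up a : subalg k.-1 k a ->
  subalg k k.+1 a by apply: subalg_mono; lia.
have TTk : T k * T k = 1 + e *: T k by apply: TT; lia.
have hC : subalg k k.+1 (C k) by apply: subalg_C.
apply: span_mulLR => _ [[a ha ->]|[k0 [a [b [ha hb ->]]]]].
  have /(T_subalg_comm HCpres (leqnn k)) Ta := ha.
  have -> : T k * (a * C k) * T k = a * C k.+1 + e *: (a * T k * C k).
    rewrite mulrA Ta -(mulrA a) TC0 -!mulrA TTk !mulrDr !mulr1.
    by rewrite -!scalerAr.
  apply: spanD; first by apply: span_mem; left; exists a => //; apply: up.
  apply: spanZ; right; split=> //; exists a, (C k); split=> //; exact: up.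
have /(T_subalg_comm HCpres (leqnn k)) Ta := ha.
have /(T_subalg_comm HCpres (leqnn k)) Tb := hb.
case: k k0 kn up {TTk hC} Ta Tb ha hb => // k _ kn up Ta Tb ha hb.
apply: span_mem; right; split=> //; exists (a * T k), (T k * b).
split; [by apply: subalgM (up _ ha) _; apply: subalg_T
       |by apply: subalgM _ (up _ hb); apply: subalg_T|].
rewrite /= !mulrA Ta -!mulrA -Tb; congr (_ * _).
by rewrite !mulrA T_braid.
Qed.

Lemma above_T k a b : subalg k k.+1 a -> subalg k k.+1 b ->
  above k.+1 (a * T k * b).
Proof. by move=> ha hb; apply: span_mem; right; split=> //; exists a, b. Qed.

(** The projections of [X k] and of [C k * X k] to the algebra on [k]
    strands are 1 and 0. Both facts pass from [k] to [k.+1] since X_(k+1) is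
    T_k X_k T_k up to an element of the complement, and since C_(k+1) T_k =
    T_k C_k. *)
Lemma above_X k : (k < n)%N -> above k (X k - 1) /\ above k (C k * X k).
Proof.
elim: k => [|k IHk] kn.
  split; first by rewrite subrr; apply: span0.
  by apply: span_mem; left; exists 1; [apply: subalg1 | rewrite mulr1 mul1r].
have [h1 hC] := IHk (ltnW kn).
have TTk : T k * T k = 1 + e *: T k by apply: TT; lia.
have sC : subalg k k.+1 (C k) by apply: subalg_C.
have sX := X_subalg k.
have EX : X k.+1 = T k * X k * T k + e *: (C k * X k * T k * C k).
  rewrite /= !mulrDl -!scalerAl; congr (_ + _ *: _).
  by rewrite -!mulrA TC0 !mulrA -(mulrA (C k) (X k)) -X_comm_C // !mulrA.
split.
  have -> : X k.+1 - 1 = T k * (X k - 1) * T k +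
      (e *: (1 * T k * 1) + e *: (C k * X k * T k * C k)).
    rewrite EX (mulrBr (T k)) mulrBl (mulr1 (T k)) TTk mulr1 mul1r opprD !addrA.
    by rewrite subrK addrAC.
  apply: spanD; first exact: above_TT.
  by apply: spanD; apply/spanZr/above_T => //;
    [apply: subalg1..|apply: subalgM].
have -> : C k.+1 * X k.+1 =
  T k * (C k * X k) * T k - e *: (C k * X k * T k * 1).
  rewrite EX mulrDr mulr1 !mulrA -TC0; congr (_ + _).
  rewrite -scalerAr -scalerN; congr (_ *: _).
  rewrite !mulrA C_anti ?mulNr; last lia.
  rewrite -!mulrA TC0 (mulrA (X k)) -X_comm_C // !mulrA.
  by rewrite -(mulrA (C k) (C k.+1) (C k.+1)) CC ?mulr1.
apply: spanB; first exact: above_TT.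
by apply/spanZr/above_T; [apply: subalgM | apply: subalg1].
Qed.

(** One of the defining relations of the affine Hecke-Clifford algebra, here
    a consequence of the recursive definition of the [X k]. *)
Lemma T_X k : (k.+1 < n)%N ->
  T k * X k.+1 = X k * T k + e *: X k.+1 - e *: (C k * C k.+1 * X k.+1).
Proof.
move=> kn; pose t := T k; pose c := C k; pose d := C k.+1; pose W := X k * t.
have tt : t * t = 1 + e *: t by apply: TT; lia.
have dc : d * c = - (c * d) by apply: C_anti; lia.
have cc : c * c = 1 by apply: CC; lia.
have dd : d * d = 1 by apply: CC.
have EX : X k.+1 = t * W + e *: (c * d * W).
  by rewrite /= -mulrA mulrDl -scalerAl.
rewrite -/W; clearbody W.
have E1 : t * (t * W) = W + e *: (t * W).
  by rewrite mulrA tt mulrDl mul1r -scalerAl.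
have td : t * d = c * t - e *: (c - d) by apply: TC1; lia.
have E2 : t * (c * d * W) = - (c * d * (t * W)) + e *: (c * d * W) + e *: W.
  have -> : t * (c * d * W) = d * (t * d) * W.
    by rewrite mulrA (mulrA t c d) (mulrA d t d) [t * c]TC0.
  rewrite td mulrBr -scalerAr mulrBr dd dc mulrBl -scalerAl mulrBl mul1r.
  by rewrite (mulrA d c t) dc !mulNr scalerBr scalerN opprD !opprK -!mulrA
    !addrA.
have E3 : c * d * (c * d * W) = - W.
  by rewrite !mulrA -(mulrA c d c) dc mulrN mulrA cc mul1r !mulNr dd mul1r.
rewrite -/t -/c -/d EX mulrDr E1 -scalerAr E2.
rewrite [c * d * (_ + _)]mulrDr -scalerAr E3.
rewrite !scalerDr !scalerN opprD opprK !addrA.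
by congr (_ + _); rewrite addrAC.
Qed.
End JucysMurphy.

(** * Reduction of even cycles under a trace *)

(** The indices of the factors [T i] of the Coxeter element of the Young
    subgroup of the composition [gam], whose first point is [p]. *)
Fixpoint blocks (p : nat) (gam : seq nat) : seq nat :=
  if gam is m :: gam' then iota p m.-1 ++ blocks (p + m) gam' else [::].

Lemma blocks_cat p s t : blocks p (s ++ t) =
    blocks p s ++ blocks (p + sumn s) t.
Proof.
elim: s p => [|m s IHs] p /=; first by rewrite addn0.
by rewrite IHs catA addnA.
Qed.

Lemma mem_blocks p s i : i \in blocks p s ->
    (p <= i)%N /\ (i.+1 < p + sumn s)%N.
Proof.
elim: s p => //= m s IHs p; rewrite mem_cat => /orP[|/IHs]; last lia.
by rewrite mem_iota; lia.
Qed.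

Lemma size_sumn s : all (leq 1) s -> (size s <= sumn s)%N.
Proof. by elim: s => //= x s IHs /andP[x0 /IHs]; lia. Qed.

Lemma perm_adjacent (S : Type) (f : seq nat -> S) :
  (forall s1 a b s2, f (s1 ++ a :: b :: s2) = f (s1 ++ b :: a :: s2)) ->
  forall s t, perm_eq s t -> f s = f t.
Proof.
move=> + s; elim: s f => [|x s IHs] f swap t pt.
  by have := perm_size pt; case: t {pt}.
have front t1 t2 : f (t1 ++ x :: t2) = f (x :: t1 ++ t2).
  elim/last_ind: t1 t2 => //= t1 y IH t2.
  by rewrite cat_rcons swap IH cat_rcons.
have xt : x \in t by rewrite -(perm_mem pt) mem_head.
move: pt; case/splitPr: xt => t1 t2 pt; rewrite front.
apply: (IHs (fun s => f (x :: s))); first by move=> s1 *;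
  apply: (swap (x :: s1)).
by rewrite -(perm_cons x) (perm_trans pt) // perm_catC /= perm_cons perm_catC.
Qed.

Section TraceOnCoxeter.
Variables (R : comUnitRingType) (e : R) (n : nat) (A : algType R).
Variables (T C : nat -> A).
Hypothesis HCpres : presentation e n T C.
Local Notation Tword := (Tword T).
Let T_comm := presT_comm HCpres.
Let T_braid := presT_braid HCpres.
Let CC := presCC HCpres.
Let C_anti := presC_anti HCpres.
Let TC0 := presTC0 HCpres.
Let TC1 := presTC1 HCpres.
Let TC := presTC HCpres.

Lemma Tword_comm y u : (forall i, i \in u -> y * T i = T i * y) ->
  y * Tword u = Tword u * y.
Proof.
elim: u => [|i u IHu] hu; first by rewrite Tword_nil mulr1 mul1r.
rewrite Tword_cons mulrA hu ?mem_head // -!mulrA IHu // => j ju.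
by apply: hu; rewrite in_cons ju orbT.
Qed.

Lemma iota_split p l i : (i < l)%N ->
  iota p l = iota p i ++ p + i :: iota (p + i).+1 (l - i.+1).
Proof.
move=> il; set d := (l - i.+1)%N; have -> : l = (i + d.+1)%N by rewrite /d; lia.
by rewrite iotaD.
Qed.

Lemma block_C p l i : (i < l)%N ->
  Tword (iota p l) * C (p + i) = C (p + i).+1 * Tword (iota p l).
Proof.
move=> il; rewrite (iota_split p il) Tword_cat Tword_cons -!mulrA.
rewrite -(Tword_comm (y := C (p + i))); last first.
  by move=> j; rewrite mem_iota => hj; apply/esym/TC; lia.
rewrite (mulrA (T _)) TC0 -!mulrA [RHS]mulrA (Tword_comm (y := C (p + i).+1) (u
  := iota p i)) ?mulrA //.
by move=> j; rewrite mem_iota => hj; apply/esym/TC; lia.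
Qed.

Lemma block_T p l i : (i.+1 < l)%N ->
  Tword (iota p l) * T (p + i) = T (p + i).+1 * Tword (iota p l).
Proof.
move=> il; have -> : iota p l = iota p i ++ [:: (p + i)%N;
  (p + i).+1] ++ iota (p + i).+2 (l - i.+2).
  set d := (l - i.+2)%N; have -> : l = (i + d.+2)%N by rewrite /d; lia.
  by rewrite iotaD.
rewrite !Tword_cat Tword_cons Tword1 -!mulrA -(Tword_comm (y := T (p + i)));
  last first.
  by move=> j; rewrite mem_iota => hj; apply: T_comm; lia.
have -> : T (p + i) * (T (p + i).+1 * (T (p + i) * Tword (iota (p + i).+2 (l -
  i.+2)))) =
    T (p + i).+1 * (T (p + i) * (T (p + i).+1 * Tword (iota (p + i).+2 (l -
      i.+2)))).
  by rewrite !mulrA T_braid.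
rewrite [RHS]mulrA (Tword_comm (y := T (p + i).+1) (u := iota p i)) ?mulrA //.
by move=> j; rewrite mem_iota => hj; apply: T_comm; lia.
Qed.

(** The term of index j omits one factor [T i], which cuts the cycle in two. *)
Lemma C_block p l : (p + l < n)%N ->
  C p * Tword (iota p l) = Tword (iota p l) * C (p + l) +
   e *: \sum_(j < l) Tword (iota p j) * (C (p + j) - C (p + j).+1) *
          Tword (iota (p + j).+1 (l - j.+1)).
Proof.
elim: l => [|l IHl] pl.
  by rewrite Tword_nil big_ord0 scaler0 addn0 addr0 mulr1 mul1r.
have iotaS a k : iota a k.+1 = rcons (iota a k) (a + k).
  by rewrite -addn1 iotaD cats1.
rewrite iotaS big_ord_recr /= Tword_rcons mulrA IHl ?mulrDl; last lia.
have -> : Tword (iota p l) * C (p + l) * T (p + l) =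
    Tword (iota p l) * T (p + l) * C (p + l.+1) +
    e *: (Tword (iota p l) * (C (p + l) - C (p + l).+1) * Tword (iota (p +
      l).+1 (l.+1 - l.+1))).
  rewrite subnn Tword_nil mulr1 addnS -!mulrA TC1; last lia.
  by rewrite scalerAr -mulrDr subrK.
rewrite -addrA; congr (_ + _); rewrite addrC scalerDr; congr (_ + _).
rewrite -scalerAl mulr_suml; congr (_ *: _); apply: eq_bigr => j _.
have -> : (l.+1 - j.+1 = (l - j.+1).+1)%N by have := ltn_ord j; lia.
rewrite iotaS Tword_rcons -!mulrA; do 3!congr (_ * _).
by congr T; have := ltn_ord j; lia.
Qed.

Variable g : {scalar A}.
Hypothesis gM : forall a b, g (a * b) = g (b * a).
Hypothesis two_unit : (2%:R : R) \is a GRing.unit.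

Lemma twice_inj (x y : R) : 2%:R * x = 2%:R * y -> x = y.
Proof. exact: (mulrI two_unit). Qed.

(** Moving C_i around the trace replaces it by C_(i+1), because the cycle
    carries C_i to C_(i+1) without lower-order terms, and changes the sign
    by anticommutation with the last C. After [l] such moves it meets the
    last C. *)
Lemma trace_CC_block h p l : (p + l < n)%N ->
  (forall j, (p <= j <= p + l)%N -> h * C j = C j * h) ->
  g (h * C (p + l) * C p * Tword (iota p l)) =
    (-1) ^+ l * g (h * Tword (iota p l)).
Proof.
move=> pl hC.
suff H i : (i <= l)%N ->
  g (h * C (p + l) * C (p + (l - i)) * Tword (iota p l)) =
    (-1) ^+ i * g (h * Tword (iota p l)).
  by have := H l (leqnn l); rewrite subnn addn0.
elim: i => [|i IHi] il.
  by rewrite subn0 expr0 mul1r -(mulrA h) CC ?mulr1.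
have pi : (p + (l - i.+1)).+1 = (p + (l - i))%N by lia.
rewrite exprS mulN1r mulNr -IHi ?(ltnW il) // -pi.
set j := (p + (l - i.+1))%N; have jl : j != (p + l)%N by rewrite /j; lia.
rewrite -(mulrA h) (C_anti (i := p + l)) 1?eq_sym // mulrN mulNr raddfN;
  congr (- _).
rewrite mulrA (hC j); last by rewrite /j; lia.
have Bj : Tword (iota p l) * C j = C j.+1 * Tword (iota p l).
  by apply: block_C; lia.
by rewrite -2!(mulrA (C j)) [LHS]gM -(mulrA _ _ (C j)) Bj !mulrA.
Qed.

(** The trace at h C_e C_p W, with W the product over the cycle, p its first
    and e its last point, is computed in two ways. By the previous lemma it
    is the opposite of the value at h W, since the cycle is even; moving C_p
    through W it is the value at h W plus the contributions of the cycles
    cut in two. There C_e and a C in the other part contribute 0 by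
    supercommutation, while C_e and a C in the same part are treated by the
    previous lemma. *)
Lemma even_block h p l : (p + l < n)%N -> odd l ->
  (forall j, (p <= j <= p + l)%N -> h * C j = C j * h) ->
  (forall j, (p <= j < p + l)%N -> h * T j = T j * h) ->
  2%:R * g (h * Tword (iota p l)) =
    e * \sum_(j < l) (-1) ^+ (l - j.+1) *
      g (h * (Tword (iota p j) * Tword (iota (p + j).+1 (l - j.+1)))).
Proof.
move=> pl ol hC hT.
have H := trace_CC_block pl hC; rewrite -signr_odd ol expr1 mulN1r in H.
have hE : h * C (p + l) = C (p + l) * h by apply: hC; lia.
have H3 : g (h * C (p + l) * Tword (iota p l) * C (p + l)) =
  g (h * Tword (iota p l)).
  by rewrite gM !mulrA -hE -(mulrA h (C _)) CC // mulr1.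
rewrite -(mulrA (h * _)) C_block // mulrDr mulrA -scalerAr mulr_sumr in H.
rewrite raddfD /= H3 linearZ /= raddf_sum /= in H.
rewrite mulr_natl mulr2n -[X in X + _]opprK -H opprD addrAC addNr add0r -mulrN.
congr (_ * _); rewrite -sumrN; apply: eq_bigr => j _.
have jl := ltn_ord j; set a := Tword (iota p j); set b := Tword _.
have Ca : C (p + l) * a = a * C (p + l).
  by apply: Tword_comm => i; rewrite mem_iota => hi; apply/esym/TC; lia.
have ha : h * C (p + l) * (a * (C (p + j) - C (p + j).+1) * b) =
   h * a * C (p + l) * C (p + j) * b - h * a * C (p + l) * C (p + j).+1 * b.
  rewrite mulrBr mulrBl mulrBr -!mulrA; congr (_ - _); congr (_ * _);
    by rewrite !mulrA Ca.
rewrite ha raddfB /=.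
(* The factors C_e b and h a C_(p+j) are odd and supercommute. *)
have -> : g (h * a * C (p + l) * C (p + j) * b) = 0.
  have E : C (p + l) * b * (h * a * C (p + j)) =
    h * a * C (p + l) * C (p + j) * b.
    have hb : b * h = h * b.
      by apply/esym/Tword_comm => i; rewrite mem_iota => hi; apply: hT; lia.
    have ab : b * a = a * b.
      apply: Tword_comm => i; rewrite mem_iota => hi;
        apply/esym/Tword_comm => k.
      by rewrite mem_iota => hk; apply: T_comm; lia.
    have Cb : b * C (p + j) = C (p + j) * b.
      by apply/esym/Tword_comm => i; rewrite mem_iota => hi; apply/esym/TC; lia.
    rewrite -!mulrA (mulrA b h) hb !mulrA -hC ?leq_addr ?leqnn //.
    rewrite -!mulrA (mulrA b a) ab -!mulrA Cb (mulrA (C (p + l)) a) Ca.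
    by rewrite !mulrA.
  have E' : h * a * C (p + l) * C (p + j) * b =
    - (h * a * C (p + j) * (C (p + l) * b)).
    rewrite -(mulrA (h * a)) C_anti ?mulrN ?mulNr ?mulrA //; lia.
  have : g (h * a * C (p + l) * C (p + j) * b) =
    - g (h * a * C (p + l) * C (p + j) * b).
    by rewrite {1}E' raddfN /= gM E.
  move=> E0; apply: twice_inj; rewrite mulr0 mulr_natl mulr2n {1}E0 addNr //.
rewrite sub0r opprK.
have := @trace_CC_block (h * a) (p + j).+1 (l - j.+1).
have -> : ((p + j).+1 + (l - j.+1) = p + l)%N by lia.
move=> -> //; first by rewrite mulrA.
move=> i hi; rewrite -mulrA.
have -> : a * C i = C i * a.
  by apply/esym/Tword_comm => k; rewrite mem_iota => hk; apply/esym/TC; lia.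
by rewrite !mulrA hC //; lia.
Qed.
End TraceOnCoxeter.

(** * The trace at all compositions *)

Section TraceOnCompositions.
Variables (R : comUnitRingType) (e : R) (n : nat) (A : algType R).
Variables (T C : nat -> A).
Hypothesis HCpres : presentation e n T C.
Local Notation Tword := (Tword T).
Let TT := presTT HCpres.
Let T_comm := presT_comm HCpres.
Let TC := presTC HCpres.

Lemma Tword_inv u : (forall i, i \in u -> (i < n.-1)%N) ->
  exists2 v, Tword u * v = 1 & v * Tword u = 1.
Proof.
elim: u => [|i u IHu] hu; first by exists 1; rewrite Tword_nil mulr1.
have [|v uv vu] := IHu; first by move=> j ju; apply: hu;
  rewrite in_cons ju orbT.
have TTi : T i * T i = 1 + e *: T i by apply/TT/hu/mem_head.
exists (v * (T i - e *: 1)); rewrite Tword_cons.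
  rewrite -mulrA (mulrA (Tword u)) uv mul1r mulrBr TTi -scalerAr mulr1.
  by rewrite addrK.
rewrite -mulrA (mulrA _ (T i)) mulrBl TTi -scalerAl mul1r addrK mul1r.
exact: vu.
Qed.

Lemma conj_iota D s t l :
  (forall i, (i < l)%N -> D * T (s + i) = T (t + i) * D) ->
  D * Tword (iota s l) = Tword (iota t l) * D.
Proof.
elim: l s t => [|l IHl] s t hl; first by rewrite Tword_nil mulr1 mul1r.
have h0 : D * T s = T t * D by have := hl 0%N isT; rewrite !addn0.
rewrite /= !Tword_cons mulrA h0 -!mulrA (IHl _ t.+1) // => i il.
by rewrite !addSnnS hl.
Qed.

(** Conjugation by a Coxeter element shifts the generators, except for the
    last one, which reaches the first one under the square of the Coxeter
    element. *)
Lemma block_pow p l k i : (i + k < l)%N ->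
  Tword (iota p l) ^+ k * T (p + i) = T (p + i + k) * Tword (iota p l) ^+ k.
Proof.
elim: k i => [|k IHk] i ik; first by rewrite mul1r mulr1 addn0.
rewrite exprSr -mulrA (block_T HCpres); last lia.
rewrite mulrA -addnS IHk; last lia.
by rewrite -mulrA; congr (T _ * _); lia.
Qed.

Lemma block_sqr p l : (0 < l)%N ->
  Tword (iota p l) ^+ 2 * T (p + l.-1) = T p * Tword (iota p l) ^+ 2.
Proof.
case: l => // l _ /=; set d := Tword _.
have dE : d = Tword (iota p l) * T (p + l).
  by rewrite /d -[p :: _]/(iota p l.+1) -addn1 iotaD cats1 Tword_rcons.
have shift : d * Tword (iota p l) = Tword (iota p.+1 l) * d.
  by apply: conj_iota => i hi; rewrite (@block_T _ _ _ _ _ _ HCpres p l.+1 i).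
have dE' : d = T p * Tword (iota p.+1 l) by rewrite -Tword_cons.
have E : d * d = Tword (iota p.+1 l) * d * T (p + l) by rewrite {2}dE mulrA
  shift.
by rewrite expr2 [in RHS]E !mulrA -dE'.
Qed.

(** Conjugation by the Coxeter element of the union of the two blocks is a
    rotation of its generators, so its power [b] exchanges the blocks. *)
Lemma swap_blocks_conj p a b : (0 < a)%N -> (0 < b)%N ->
  let D := Tword (iota p (a + b).-1) ^+ b in
  D * (Tword (iota p a.-1) * Tword (iota (p + a) b.-1)) =
  Tword (iota p b.-1) * Tword (iota (p + b) a.-1) * D.
Proof.
move=> a0 b0 D.
have E1 : D * Tword (iota p a.-1) = Tword (iota (p + b) a.-1) * D.
  apply: conj_iota => i hi.
  by rewrite block_pow; [congr (T _ * _); lia | lia].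
have E2 : D * Tword (iota (p + a) b.-1) = Tword (iota p b.-1) * D.
  apply: conj_iota => i hi.
  pose d := Tword (iota p (a + b).-1).
  (* The generator moves up to the last place, jumps to the first one under
     [d ^+ 2], then moves up again. *)
  have hD : D = d ^+ i * (d ^+ 2 * d ^+ (b - i.+2)).
    by rewrite /D -!exprD; congr (_ ^+ _); lia.
  have Ek : d ^+ (b - i.+2) * T (p + a + i) =
    T (p + (a + b).-1.-1) * d ^+ (b - i.+2).
    by rewrite -(addnA p) block_pow; [congr (T _ * _); lia | lia].
  have E2 : d ^+ 2 * T (p + (a + b).-1.-1) = T p * d ^+ 2 by apply: block_sqr;
    lia.
  have Ei : d ^+ i * T p = T (p + i) * d ^+ i.
    by rewrite -[p in T p]addn0 block_pow; [congr (T _ * _); lia | lia].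
  rewrite hD -(mulrA (d ^+ i)) -(mulrA (d ^+ 2)) Ek (mulrA (d ^+ 2)) E2.
  by rewrite -(mulrA (T p)) (mulrA (d ^+ i) (T p)) Ei -(mulrA (T (p + i))).
rewrite mulrA E1 -mulrA E2 mulrA; congr (_ * _).
apply: Tword_comm => i; rewrite mem_iota => hi; apply/esym/Tword_comm => j.
by rewrite mem_iota => hj; apply: T_comm; lia.
Qed.

Variable g : {scalar A}.
Hypothesis gM : forall a b, g (a * b) = g (b * a).

Lemma trace_swap s1 a b s2 : (0 < a)%N -> (0 < b)%N ->
  sumn (s1 ++ a :: b :: s2) = n ->
  g (Tword (blocks 0 (s1 ++ a :: b :: s2))) =
  g (Tword (blocks 0 (s1 ++ b :: a :: s2))).
Proof.
move=> a0 b0 sn; rewrite !blocks_cat /= !add0n; set p := sumn s1.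
rewrite sumn_cat /= -/p in sn.
have -> : (p + b + a = p + a + b)%N by lia.
set u := blocks 0 s1; set v := blocks _ s2.
have hu i : i \in u -> (i.+1 < p)%N by move=> /mem_blocks[_]; rewrite add0n.
have hv i : i \in v -> (p + a + b <= i)%N by case/mem_blocks.
have [|V DV VD] := @Tword_inv (iota p (a + b).-1).
  by move=> i; rewrite mem_iota; lia.
have h := swap_blocks_conj p a0 b0; set d := Tword _ in DV VD h; cbv zeta in h.
have DVb : d ^+ b * V ^+ b = 1.
  have cVd : GRing.comm d V by rewrite /GRing.comm DV VD.
  by rewrite -exprMn_comm // DV expr1n.
rewrite !Tword_cat !(mulrA (Tword (iota _ _)));
  set h1 := Tword (iota p a.-1) * _ in h *.
set h2 := Tword (iota p b.-1) * _ in h *.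
have E1 : h1 = V ^+ b * (h2 * d ^+ b).
  have VDb : V ^+ b * d ^+ b = 1.
    have cVd : GRing.comm V d by rewrite /GRing.comm DV VD.
    by rewrite -exprMn_comm // VD expr1n.
  by rewrite -h mulrA VDb mul1r.
have dT w : (forall i, i \in w -> (i.+1 < p)%N || (p + a + b <= i)%N) ->
    d ^+ b * Tword w = Tword w * d ^+ b.
  move=> hw; apply/commr_sym/commrX; rewrite /GRing.comm; apply/esym/Tword_comm.
  move=> i /hw hi; apply/esym/Tword_comm => j; rewrite mem_iota => hj.
  by apply: T_comm; lia.
have dv : d ^+ b * Tword v = Tword v * d ^+ b.
  by apply: dT => i /hv ->; rewrite orbT.
have du : d ^+ b * Tword u = Tword u * d ^+ b by apply: dT => i /hu ->.
clearbody h1 h2; rewrite E1; move: (d ^+ b) (V ^+ b) DVb dv du =>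
  D' V' DV' dv du.
rewrite -!mulrA dv !mulrA gM -!mulrA (mulrA D') du -!mulrA (mulrA D') DV'.
by rewrite mul1r !mulrA.
Qed.

Hypothesis two_unit : (2%:R : R) \is a GRing.unit.

Lemma alternating_sum l : \sum_(j < l) (-1) ^+ (l - j.+1) = (odd l)%:R :> R.
Proof.
elim: l => [|l IHl]; first by rewrite big_ord0.
rewrite big_ord_recr /= subnn expr0.
have -> : \sum_(j < l) (-1) ^+ (l.+1 - j.+1) = - (odd l)%:R :> R.
  rewrite -IHl -sumrN; apply: eq_bigr => j _; have jl := ltn_ord j.
  by rewrite (_ : (l.+1 - j.+1 = (l - j.+1).+1)%N) ?exprS ?mulN1r //; lia.
by case: (odd l); rewrite ?addNr // oppr0 add0r.
Qed.

Variable z : R.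
Hypothesis zE : e = 2%:R * z.
Hypothesis g_odd : forall nu, sorted geq nu -> all odd nu -> sumn nu = n ->
  g (Tword (blocks 0 nu)) = z ^+ (n - size nu).

(** Induction on the number of factors. When all parts are odd, only their
    order has to be corrected. When some part is even, all terms of its
    reduction have one factor less, hence equal values, and the alternating
    sum of an odd number of signs is 1. *)
Lemma trace_blocks gam : all (leq 1) gam -> sumn gam = n ->
  g (Tword (blocks 0 gam)) = z ^+ (n - size gam).
Proof.
have [m] := ubnP (n - size gam); elim: m gam => // m IHm gam hm pos sn.
have [ogam|/allPn[M]] := boolP (all odd gam).
  (* Extending by 0 makes the exchange of neighbours hold for all sequences. *)
  pose f s := if all (leq 1) s && (sumn s == n) then g (Tword (blocks 0 s))
    else 0.
  have -> : g (Tword (blocks 0 gam)) = f gam by rewrite /f pos sn eqxx.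
  have pgam : perm_eq gam (sort geq gam) by rewrite perm_sym perm_sort.
  rewrite (perm_adjacent (f := f) _ pgam) /f.
    have -> : all (leq 1) (sort geq gam) by rewrite all_sort.
    have sn' : sumn (sort geq gam) = n by rewrite -(perm_sumn pgam).
    rewrite sn' eqxx /= g_odd ?size_sort ?all_sort //.
    by apply: sort_sorted => x y; apply: leq_total.
  move=> s1 a b s2; rewrite !all_cat /= !sumn_cat /= (addnCA a) (andbCA (0 <
    a)%N).
  case: ifP => // /andP[/and4P[_ b0 a0 _] /eqP sn'].
  by apply: trace_swap => //; rewrite sumn_cat /= (addnCA a).
move=> Mg eM; case/splitPr: Mg hm pos sn => s1 s2.
rewrite size_cat /= all_cat sumn_cat /= => hm /and3P[pos1 M0 pos2] sn.
set p := sumn s1 in sn.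
case: M eM M0 sn => // l /= ol _ sn; rewrite negbK in ol.
have := size_sumn pos1; rewrite -/p => hs1; have hs2 := size_sumn pos2.
have l0 : (0 < l)%N by case: (l) ol.
apply: (twice_inj two_unit).
have gE a : g (Tword (blocks 0 s1 ++ a ++ blocks (p + l.+1) s2)) =
    g (Tword (blocks (p + l.+1) s2) * Tword (blocks 0 s1) * Tword a).
  by rewrite !Tword_cat mulrA gM mulrA.
have hu i : i \in blocks 0 s1 -> (i.+1 < p)%N by move=> /mem_blocks[_];
  rewrite add0n.
have hv i : i \in blocks (p + l.+1) s2 -> (p + l.+1 <= i)%N by case/mem_blocks.
rewrite blocks_cat /= add0n -/p gE (even_block HCpres gM two_unit) //;
  first last.
- move=> j hj; rewrite -mulrA -(Tword_comm (y := T j)); last first.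
    by move=> i /hu hi; apply: T_comm; lia.
  rewrite !mulrA -(Tword_comm (y := T j)) //.
  by move=> i /hv hi; apply: T_comm; lia.
- move=> j hj; rewrite -mulrA -(Tword_comm (y := C j)); last first.
    by move=> i /hu hi; apply/esym/TC; lia.
  rewrite !mulrA -(Tword_comm (y := C j)) //.
  by move=> i /hv hi; apply/esym/TC; lia.
- lia.
have -> : (n - (size s1 + (size s2).+1) = (n - (size s1 + (size s2).+2)).+1)%N.
  by move: hs1 hs2; set a := size s1; set b := size s2; lia.
rewrite exprS mulrA -zE; congr (_ * _).
(* There are [l] terms, and [l] is odd because the cycle has [l.+1] points. *)
have E : \sum_(j < l) (-1) ^+ (l - j.+1) = 1 :> R by rewrite alternating_sum ol.
rewrite -[RHS]mul1r -[in RHS]E mulr_suml; apply: eq_bigr => j _.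
have jl := ltn_ord j; congr (_ * _).
rewrite -(Tword_cat _ (iota p j)) -gE.
have := IHm (s1 ++ j.+1 :: (l - j)%N :: s2).
rewrite size_cat /= all_cat /= pos1 pos2 sumn_cat /= blocks_cat /= add0n -/p.
rewrite -!addnS !addnA => <-; try lia.
congr (g (Tword _)); congr (_ ++ _); rewrite -catA; congr (_ ++ _).
rewrite addnS; congr (_ ++ _); first by congr iota; lia.
by congr blocks; lia.
Qed.
End TraceOnCompositions.

(** * Comparison of the trace with the form *)

Section Comparison.
Variables (R : comUnitRingType) (e : R) (n : nat) (A : algType R).
Variables (T C : nat -> A).
Hypothesis HCpres : presentation e n T C.
Local Notation Tword := (Tword T).
Local Notation word := (word T C).
Local Notation subalg := (subalg T C).
Local Notation above := (above T C).
Local Notation X := (jucys_murphy e T C).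

Variable tau : {scalar A}.
Hypothesis tauP : forall f u, normal_word n.-1 u ->
  tau (Cpow n C f * Tword u) = (all (fun i =>
    ~~ f i) (iota 0 n) && (u == [::]))%:R.
Variable g : {scalar A}.
Hypothesis gM : forall a b, g (a * b) = g (b * a).
Hypothesis g_oddC : forall s, all (in_rank n.-1 n) s -> odd (count isC s) ->
  g (word s) = 0.
Hypothesis two_unit : (2%:R : R) \is a GRing.unit.
Variable z : R.
Hypothesis zE : e = 2%:R * z.
Hypothesis g_odd : forall nu, sorted geq nu -> all odd nu -> sumn nu = n ->
  g (Tword (blocks 0 nu)) = z ^+ (n - size nu).

Definition Xprod k : A := \prod_(i < k) (1 + X i).

Lemma XprodS k : Xprod k.+1 = Xprod k * (1 + X k).
Proof. exact: big_ord_recr. Qed.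

Lemma Xprod_subalg k : subalg k.-1 k (Xprod k).
Proof.
apply: big_rec => [|i a _ ha]; first exact: subalg1.
apply: subalgM => //; apply: spanD; first exact: subalg1.
have ik := ltn_ord i.
by apply: subalg_mono (X_subalg _ _ _ _) => //; lia.
Qed.

Lemma tau_above0 k a y b : (k < n)%N -> subalg k.-1 k a -> subalg k.-1 k b ->
  above k y -> tau (a * y * b) = 0.
Proof.
move=> kn ha hb hy; apply: (tau_above HCpres tauP kn).
exact: (aboveM HCpres).
Qed.

Lemma tau_X k a b : (k < n)%N -> subalg k.-1 k a -> subalg k.-1 k b ->
  tau (a * X k * b) = tau (a * b).
Proof.
move=> kn ha hb; have [h1 _] := above_X HCpres kn.
have -> : a * X k * b = a * (X k - 1) * b + a * b.
  by rewrite mulrBr mulr1 mulrBl subrK.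
by rewrite raddfD /= (tau_above0 kn ha hb h1) add0r.
Qed.

(** The factor 1 + X_k contributes the projection of X_k, which is 1. *)
Lemma tau_XprodS k h : (k < n)%N -> subalg k.-1 k h ->
  tau (h * Xprod k.+1) = 2%:R * tau (h * Xprod k).
Proof.
move=> kn hh; rewrite XprodS mulrDr mulr1 mulrDr raddfD /= mulr_natl mulr2n.
congr (_ + _); have := tau_X kn (subalgM hh (Xprod_subalg k)) (subalg1 _ _ _ _).
by rewrite !mulr1 !mulrA.
Qed.

Lemma tau_C_Xprod k a : (k < n)%N -> subalg k.-1 k a ->
  tau (a * C k * Xprod k.+1) = 0.
Proof.
move=> kn ha; rewrite XprodS mulrDr mulr1 mulrDr raddfD /=.
have hP := Xprod_subalg k; have [_ hC] := above_X HCpres kn.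
rewrite (tau_above0 kn ha hP); last first.
  by apply: span_mem; left; exists 1; rewrite ?mul1r //; apply: subalg1.
rewrite -(X_comm_low HCpres kn hP) add0r -(mulrA a) (mulrA (C k)) mulrA.
exact: (tau_above0 kn ha hP hC).
Qed.

(** X_(k+1) commutes with everything on its left up to T_k, and T_k X_(k+1)
    is e X_(k+1) up to terms killed by tau. *)
Lemma tau_T_Xprod k a b : (k.+1 < n)%N -> subalg k k.+1 a -> subalg k k.+1 b ->
  tau (a * T k * b * Xprod k.+2) = e * tau (a * b * Xprod k.+1).
Proof.
move=> kn ha hb; rewrite XprodS mulrDr mulr1 mulrDr raddfD /=.
have hP : subalg k k.+1 (Xprod k.+1) := Xprod_subalg k.+1.
have [_ hC] := above_X HCpres kn.
have above_Tk c d : subalg k k.+1 c -> subalg k k.+1 d -> tau (c * T k * d) = 0.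
  move=> hc hd; apply: (tau_above HCpres tauP kn); exact: above_T.
rewrite -(mulrA (_ * T k)) above_Tk ?add0r; [|done|exact: subalgM].
rewrite -(mulrA (_ * T k) b) (mulrA b) -(X_comm_low HCpres kn (subalgM hb hP)).
have hbP := subalgM hb hP.
have -> : a * T k * (X k.+1 * (b * Xprod k.+1)) =
    a * X k * T k * (b * Xprod k.+1) + e *: (a * X k.+1 * (b * Xprod k.+1)) -
    e *: (a * C k * (C k.+1 * X k.+1) * (b * Xprod k.+1)).
  have := T_X HCpres kn; move: (X k.+1) (b * Xprod k.+1) => Y Z TX.
  rewrite mulrA -(mulrA a) TX mulrBr mulrDr mulrBl mulrDl.
  by rewrite -!scalerAr -!scalerAl !mulrA.
have haC : subalg k k.+1 (a * C k) by apply: subalgM => //; apply: subalg_C.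
have haX : subalg k k.+1 (a * X k) by apply: subalgM => //; apply: X_subalg.
rewrite raddfB raddfD /= !linearZ /= (above_Tk _ _ haX hbP) (tau_X kn ha hbP).
by rewrite (tau_above0 kn haC hbP hC) add0r mulr0 subr0 mulrA.
Qed.

Lemma Tword_subalg_comm k u a : (forall i, i \in u -> (k <= i)%N) ->
  subalg k.-1 k a -> a * Tword u = Tword u * a.
Proof.
move=> hu ha; apply: Tword_comm => i /hu ki.
by apply/esym/(T_subalg_comm HCpres ki).
Qed.

(** If the word is odd, it anticommutes with C_k and commutes with the
    cycles, so the trace property makes the value equal to its opposite. If
    it is even, the whole product is odd. *)
Lemma trace_C_block k s gam : (k < n)%N -> all (in_rank k.-1 k) s ->
  sumn gam = (n - k)%N -> g (word s * C k * Tword (blocks k gam)) = 0.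
Proof.
move=> kn hs sg; set u := blocks k gam.
have hu i : i \in u -> (k <= i)%N by case/mem_blocks.
have hun i : i \in u -> (i < n.-1)%N by case/mem_blocks; rewrite sg; lia.
have cu := Tword_subalg_comm hu (subalg_word T C hs).
have [os|es] := boolP (odd (count isC s)).
  have Cs := C_word_rank HCpres (leqnn k) hs.
  rewrite -signr_odd os expr1 scaleN1r in Cs.
  apply: (twice_inj two_unit); rewrite mulr0 mulr_natl mulr2n.
  apply/eqP; rewrite addr_eq0; apply/eqP.
  by rewrite {1}Cs mulNr raddfN /= -(mulrA (C k)) cu mulrA gM mulrA.
have -> : word s * C k * Tword u = word (s ++ inr k :: [seq inl i | i <- u]).
  rewrite word_cat word_cons -mulrA; congr (_ * (_ * _)).
  by rewrite /word big_map.
apply: g_oddC.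
  rewrite all_cat /= kn all_map; apply/and3P; split=> //.
    by apply: sub_all hs => -[i|i] /=; lia.
  by apply/allP => i /hun.
have c0 (v : seq nat) : count isC [seq inl i | i <- v] = 0%N by elim: v.
by rewrite count_cat /= c0 addn1 /= es.
Qed.

(** The powers of 2 are on the left to avoid inverses. The trace property of
    the form is available from the case of a lower [k] with trivial cycles,
    where it coincides with the trace; it makes the order of the two factors
    around T_k immaterial. *)
Lemma trace_tau k gam h : (k < n)%N -> all (leq 1) gam ->
    sumn gam = (n - k)%N -> subalg k k.+1 h ->
  2%:R ^+ k.+1 * g (h * Tword (blocks k gam)) =
    z ^+ (n - k - size gam) * tau (h * Xprod k.+1).
Proof.
elim: k gam h => [|k IHk] gam h kn pos sg hh.
  have hE : Rspan (layer T C 0) h by apply: (layer_full HCpres kn).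
  elim: hE => {h hh} [|x y _ IHx _ IHy|c x Lx].
  - by rewrite !mul0r !raddf0 !mulr0.
  - by rewrite !(mulrDl x y) !raddfD /= 2![_ ^+ _ * (_ + _)]mulrDr IHx IHy.
  rewrite -!scalerAl !linearZ /= !(mulrCA _ c); congr (_ * _).
  case: Lx => [[[|[i|i] s] //= _ ->]|[s hs ->]|[]] //.
    rewrite word_nil mul1r tau_XprodS //; last exact: subalg1.
    rewrite /Xprod big_ord0 mulr1 (tau1 tauP) mulr1 mulrC subn0 in sg *.
    by rewrite (trace_blocks HCpres gM two_unit zE g_odd).
  rewrite (tau_C_Xprod kn) ?mulr0; last exact: subalg_word.
  by rewrite trace_C_block ?mulr0.
have kn' := ltnW kn.
(* With all parts equal to 1 there is no factor [T i] on the right of h'. *)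
have IH1 h' : subalg k k.+1 h' -> 2%:R ^+ k.+1 * g h' = tau (h' * Xprod k.+1).
  move=> hh'; have := IHk (nseq (n - k) 1%N) h' kn'.
  have b1 m p : blocks p (nseq m 1%N) = [::] by elim: m p => //= m IHm p.
  rewrite b1 Tword_nil mulr1 size_nseq subnn mul1r; apply=> //.
    by rewrite all_nseq orbT.
  by rewrite sumn_nseq mul1n.
have hE : Rspan (layer T C k.+1) h by apply: (layer_full HCpres kn).
elim: hE => {h hh} [|x y _ IHx _ IHy|c x Lx].
- by rewrite !mul0r !raddf0 !mulr0.
- by rewrite !(mulrDl x y) !raddfD /= 2![_ ^+ _ * (_ + _)]mulrDr IHx IHy.
rewrite -!scalerAl !linearZ /= !(mulrCA _ c); congr (_ * _).
case: Lx => [[s hs ->]|[s hs ->]|[_ [s [t [hs ht ->]]]]].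
- rewrite (tau_XprodS kn); last exact: subalg_word.
  rewrite [_ ^+ k.+2]exprS -(mulrA 2%:R) [RHS]mulrCA; congr (_ * _).
  have := IHk (1%N :: gam) (word s) kn'; rewrite /= pos sg addn1 => -> //;
    try lia.
    by congr (z ^+ _ * _); lia.
  exact: subalg_word.
- rewrite (tau_C_Xprod kn) ?mulr0; last exact: subalg_word.
  by rewrite trace_C_block ?mulr0.
have /= Hs := subalg_word T C hs; have /= Ht := subalg_word T C ht.
rewrite /= (tau_T_Xprod kn) // zE.
case: gam pos sg => [|m gam] /=; first by lia.
case/andP=> m0 pos sg.
set y := Tword _.
have Ey : y * word t = word t * y.
  rewrite /y; apply/esym/(@Tword_subalg_comm k.+1) => // i.
  by rewrite -[_ ++ _]/(blocks k.+1 (m :: gam)) => /mem_blocks[].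
have -> : g (word s * T k * word t * y) =
  g (word t * word s * Tword (blocks k (m.+1 :: gam))).
  rewrite -(mulrA _ (word t)) -Ey mulrA gM -!mulrA; congr (g (_ * (_ * _))).
  rewrite -Tword_cons /=; congr (Tword _).
  by rewrite addSnnS; case: (m) m0.
have hts : subalg k k.+1 (word t * word s) by apply: subalgM.
have H := IHk (m.+1 :: gam) _ kn' _ _ hts.
rewrite [_ ^+ k.+2]exprS -[LHS]mulrA H; [|by rewrite /= pos|by rewrite /=; lia].
rewrite [size (m.+1 :: gam)]/=.
rewrite -(IH1 _ hts) gM (IH1 _ (subalgM Hs Ht)).
have := size_sumn pos => hz.
have -> : (n - k - (size gam).+1 = (n - k.+1 - (size gam).+1).+1)%N by lia.
by rewrite exprS [RHS]mulrCA !mulrA.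
Qed.

Theorem trace_eq_tau h : (0 < n)%N -> subalg n.-1 n h ->
  2%:R ^+ n * g h = tau (h * Xprod n).
Proof.
move=> n0 hh; have := @trace_tau n.-1 [:: 1%N] h.
rewrite (prednK n0) /= Tword_nil mulr1 => H.
have -> : tau (h * Xprod n) = z ^+ (n - n.-1 - 1) * tau (h * Xprod n).
  by rewrite (_ : (n - n.-1 - 1 = 0)%N) ?mul1r //; lia.
by apply: H => //; lia.
Qed.
End Comparison.

(** * Reduced words and Coxeter elements of Young subgroups *)

Section BlockEnds.
Local Open Scope nat_scope.

Lemma block_ends_cons m s : block_ends (m :: s) =
  if s is [::] then [::] else m :: [seq m + x | x <- block_ends s].
Proof.
case: s => // a s; rewrite /block_ends [LHS]/= addn0; congr (_ :: _).
rewrite -[2]/(1 + 1) iotaDl -!map_comp; apply/eq_in_map => k.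
by rewrite mem_iota => /andP[k1 _]; case: k k1.
Qed.

Lemma blocks_filter p s : all (leq 1) s ->
  blocks p s = [seq i <- iota p (sumn s).-1 | i.+1 \notin [seq p + x | x <-
    block_ends s]].
Proof.
elim: s p => [|m s IHs] p //= /andP[m0 pos]; rewrite block_ends_cons.
case: s pos IHs => [|a s] pos IHs.
  by rewrite /= cats0 addn0; apply/esym/all_filterP/allP.
rewrite (IHs (p + m) pos); set S := sumn (a :: s).
have S0 : 0 < S by rewrite /S /=; case/andP: pos; lia.
set B := block_ends _; have -> : (m + S).-1 = m.-1 + (1 + S.-1) by lia.
rewrite iotaD filter_cat; congr (_ ++ _).
  apply/esym/all_filterP/allP => i; rewrite mem_iota => hi.
  rewrite /= in_cons negb_or; apply/andP; split; first by lia.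
  by rewrite -map_comp; apply/mapP => -[x _] /=; lia.
rewrite iotaD filter_cat /= in_cons.
have -> : (p + m.-1).+1 = p + m by lia.
rewrite eqxx /=; have -> : p + m.-1 + 1 = p + m by lia.
apply: eq_in_filter => i; rewrite mem_iota => hi; rewrite in_cons.
have -> : (i.+1 == p + m) = false by lia.
rewrite -map_comp /=; congr (~~ (_ \in _)).
by apply: eq_map => x /=; rewrite addnA.
Qed.
End BlockEnds.

Section Permutations.
Variable n : nat.
Implicit Types (s : seq 'I_n.-1) (w : 'S_n).

Lemma val_transposition (i : 'I_n.-1) (x : 'I_n) :
  val (transposition i x) = swap (val x) i.
Proof.
rewrite /transposition /swap; case: tpermP => [->|->|] /=.
- by rewrite eqxx.
- by rewrite eqxx; case: eqP => //; lia.
by move=> /eqP + /eqP; rewrite -!val_eqE /= => /negPf -> /negPf ->.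
Qed.

Lemma val_word_perm s (x : 'I_n) :
  val (word_perm s x) = walk [seq val i | i <- s] (val x).
Proof.
rewrite /word_perm; elim: s x => [|i s IHs] x; first by rewrite big_nil perm1.
by rewrite big_cons permM IHs val_transposition.
Qed.

Lemma all_val_lt s : all (ltn^~ n.-1) [seq val i | i <- s].
Proof. by rewrite all_map; apply/allP => i _ /=. Qed.

Lemma walk_eq s t : word_perm s = word_perm t ->
  walk [seq val i | i <- s] =1 walk [seq val i | i <- t].
Proof.
move=> E x; have [xn|nx] := ltnP x n.
  by have := val_word_perm s (Ordinal xn); rewrite E val_word_perm.
have [n0|n0] := posnP n; last by rewrite !(walk_out (all_val_lt _)) //; lia.
suff nil (r : seq 'I_n.-1) : r = [::] by rewrite (nil s) (nil t).
by case: r => // -[i hi]; move: (hi); rewrite n0.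
Qed.

Lemma word_perm_inj s t : normal_word n.-1 [seq val i | i <- s] ->
  normal_word n.-1 [seq val i | i <- t] -> word_perm s = word_perm t -> s = t.
Proof.
by move=> hs ht /walk_eq /(normal_word_inj hs ht); apply: inj_map;
  apply: val_inj.
Qed.

Lemma ord_word (u : seq nat) : all (ltn^~ n.-1) u ->
  exists s, u = [seq val i | i <- s].
Proof.
elim: u => [|i u IHu] /=; first by exists [::].
by case/andP=> hi /IHu[s ->]; exists (Ordinal hi :: s).
Qed.

Lemma reduced_word_exists w s : word_perm s = w -> exists t, reduced_word w t.
Proof.
move=> sw; pose P m := `[< exists2 t, word_perm t = w & size t = m >].
have exP : exists m, P m by exists (size s); apply/asboolP; exists s.
case: (ex_minnP exP) => m /asboolP[t tw <-] tmin.
by exists t; split=> // r rw; apply: tmin; apply/asboolP; exists r.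
Qed.

(** The normal form of a reduced word has the same permutation, hence is the
    given normal word, and has the same length by minimality. *)
Lemma reduced_word_normal s t : normal_word n.-1 [seq val i | i <- t] ->
  reduced_word (word_perm t) s ->
    braid_eq n.-1 [seq val i | i <- s] [seq val i | i <- t].
Proof.
move=> ht [sw smin]; have [u [hu au su eu]] := word_normal_form (leqnn n.-1)
  (all_val_lt s).
have ut : u = [seq val i | i <- t].
  by apply: (normal_word_inj hu ht) => x; rewrite -au (walk_eq sw).
rewrite -ut; apply: eu; apply/eqP; rewrite eqn_leq su /= ut !size_map.
exact: smin.
Qed.
End Permutations.

(** * Transfer to the quotient of the free algebra *)

Section HeckeClifford.
Variables (R : idomainType) (q : R) (n : nat).
Local Notation HC := (HC q n).
Local Notation e := (epsilon q).

Lemma HC_piMr (g h : free_alg R n) : HC_pi q g * HC_pi q h = HC_pi q (g * h).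
Proof. exact: HC_piM. Qed.

Lemma HC_piZr c (g : free_alg R n) : c *: HC_pi q g = HC_pi q (c *: g).
Proof. exact: HC_piZ. Qed.

Lemma HC_pi1 : HC_pi q (1 : free_alg R n) = 1.
Proof. by []. Qed.

Lemma HC_piDr (g h : free_alg R n) : HC_pi q (g + h) = HC_pi q g + HC_pi q h.
Proof. exact: HC_piD. Qed.

Lemma HC_pi0 : HC_pi q (0 : free_alg R n) = 0.
Proof. by apply: (@addIr _ (HC_pi q 0)); rewrite -HC_piDr !add0r. Qed.

Lemma HC_piN (g : free_alg R n) : HC_pi q (- g) = - HC_pi q g.
Proof. by apply: (@addIr _ (HC_pi q g)); rewrite -HC_piDr !addNr HC_pi0. Qed.

Lemma HC_scalerAl c (x y : HC) : c *: (x * y) = (c *: x) * y.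
Proof.
rewrite -[x]HC_pi_repr -[y]HC_pi_repr HC_piMr !HC_piZr HC_piMr.
by rewrite scalerAl.
Qed.

Lemma free_scalerAr c (g h : free_alg R n) : c *: (g * h) = g * (c *: h).
Proof.
have Zr (f : free_alg R n) : f * malgC c = c *: f.
  rewrite malgM_def malgZ_def fgmulgU.
  by apply: eq_bigr => k _; rewrite mulm1 mulrC.
by rewrite -[c *: h]Zr mulrA Zr.
Qed.

Lemma HC_scalerAr c (x y : HC) : c *: (x * y) = x * (c *: y).
Proof.
rewrite -[x]HC_pi_repr -[y]HC_pi_repr HC_piMr !HC_piZr HC_piMr.
by rewrite free_scalerAr.
Qed.

Lemma HC_pi_rel (g h : free_alg R n) : HC_relation q g h -> HC_pi q g =
    HC_pi q h.
Proof.
move=> r; apply/eqP/HC_piP.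
by rewrite -[g - h]mul1r -[1 * (g - h)]mulr1; apply: HC_ideal_rel.
Qed.

(** The value 0 out of range keeps the braid and commutation relations valid
    for all indices. *)
Definition genT (i : nat) : HC := if insub i is Some j then HC_T q j else 0.
Definition genC (i : nat) : HC := if insub i is Some j then HC_C q j else 0.

Local Notation T := genT.
Local Notation C := genC.

Lemma genT_ord (i : 'I_n.-1) : T i = HC_T q i.
Proof. by rewrite /genT valK. Qed.
Lemma genC_ord (i : 'I_n) : C i = HC_C q i.
Proof. by rewrite /genC valK. Qed.

Lemma genT_lt i (hi : (i < n.-1)%N) : T i = HC_T q (Ordinal hi).
Proof. exact: (genT_ord (Ordinal hi)). Qed.
Lemma genC_lt i (hi : (i < n)%N) : C i = HC_C q (Ordinal hi).
Proof. exact: (genC_ord (Ordinal hi)). Qed.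

Lemma genT_out i : (n.-1 <= i)%N -> T i = 0.
Proof. by move=> hi; rewrite /genT insubF // ltnNge hi. Qed.
Lemma genC_out i : (n <= i)%N -> C i = 0.
Proof. by move=> hi; rewrite /genC insubF // ltnNge hi. Qed.

Lemma genTT i : (i < n.-1)%N -> T i * T i = 1 + e *: T i.
Proof.
move=> hi; rewrite (genT_lt hi) /HC_T HC_piMr HC_piZr addrC -HC_pi1 -HC_piDr.
by apply: HC_pi_rel; apply: HC_quadratic.
Qed.

Lemma genT_comm i j : (i.+1 < j)%N || (j.+1 < i)%N -> T i * T j = T j * T i.
Proof.
move=> hij; have [hi|/genT_out->] := ltnP i n.-1; last by rewrite mulr0 mul0r.
have [hj|/genT_out->] := ltnP j n.-1; last by rewrite mulr0 mul0r.
by rewrite (genT_lt hi) (genT_lt hj) /HC_T !HC_piMr; apply: HC_pi_rel;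
  apply: HC_commute.
Qed.

Lemma genT_braid i : T i * T i.+1 * T i = T i.+1 * T i * T i.+1.
Proof.
have [hj|/genT_out->] := ltnP i.+1 n.-1; last by rewrite !(mulr0, mul0r).
have hi := ltnW hj.
have M3 (a b c : free_alg R n) :
    HC_pi q a * HC_pi q b * HC_pi q c = HC_pi q (a * b * c).
  by rewrite (HC_piMr a b) (HC_piMr (a * b) c).
rewrite (genT_lt hi) (genT_lt hj); apply: etrans (M3 _ _ _) _.
by apply: etrans (esym (M3 _ _ _)); apply: HC_pi_rel; apply: HC_braid.
Qed.

Lemma genCC i : (i < n)%N -> C i * C i = 1.
Proof.
by move=> hi; rewrite (genC_lt hi) /HC_C HC_piMr -HC_pi1; apply: HC_pi_rel;
  apply: HC_Clifford_sqr.
Qed.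

Lemma genC_anti i j : i != j -> C i * C j = - (C j * C i).
Proof.
move=> hij; have [hi|/genC_out->] := ltnP i n;
  last by rewrite mulr0 mul0r oppr0.
have [hj|/genC_out->] := ltnP j n; last by rewrite mulr0 mul0r oppr0.
rewrite (genC_lt hi) (genC_lt hj) /HC_C !HC_piMr -HC_piN.
by apply: HC_pi_rel; apply: HC_Clifford_anti.
Qed.

Lemma genTC0 i : T i * C i = C i.+1 * T i.
Proof.
have [hi|/genT_out->] := ltnP i n.-1; last by rewrite mulr0 mul0r.
have hi1 : (i.+1 < n)%N by rewrite -ltn_predRL.
rewrite (genT_lt hi) (genC_lt (ltnW hi1)) (genC_lt hi1) /HC_T /HC_C !HC_piMr.
have [-> ->] : Ordinal (ltnW hi1) = pos0 (Ordinal hi)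
    /\ Ordinal hi1 = pos1 (Ordinal hi) by split; apply/val_inj.
by apply: HC_pi_rel; apply: HC_TC0.
Qed.

Lemma genTC1 i : (i < n.-1)%N ->
  T i * C i.+1 = C i * T i - e *: (C i - C i.+1).
Proof.
move=> hi; have hi1 : (i.+1 < n)%N by rewrite -ltn_predRL.
rewrite (genT_lt hi) (genC_lt (ltnW hi1)) (genC_lt hi1) /HC_T /HC_C !HC_piMr.
have [-> ->] : Ordinal (ltnW hi1) = pos0 (Ordinal hi)
    /\ Ordinal hi1 = pos1 (Ordinal hi) by split; apply/val_inj.
rewrite -HC_piN -HC_piDr HC_piZr -HC_piN -HC_piDr.
by apply: HC_pi_rel; apply: HC_TC1.
Qed.

Lemma genTC i j : j != i -> j != i.+1 -> T i * C j = C j * T i.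
Proof.
move=> ji ji1; have [hi|/genT_out->] := ltnP i n.-1;
  last by rewrite mulr0 mul0r.
have [hj|/genC_out->] := ltnP j n; last by rewrite mulr0 mul0r.
rewrite (genT_lt hi) (genC_lt hj) /HC_T /HC_C !HC_piMr.
by apply: HC_pi_rel; apply: HC_TC; rewrite -val_eqE.
Qed.
End HeckeClifford.

Section Bridge.
Variables (R : idomainType) (q : R) (n : nat).
Local Notation HC := (HC q n).

(** The algebra structure requires 1 to be nonzero, so the carrier is
    indexed by a proof of it. *)
Definition HCalg of (1 : HC) != 0 := HC.
Variable nz : (1 : HC) != 0.
HB.instance Definition _ := GRing.PzRing.copy (HCalg nz) HC.
HB.instance Definition _ := GRing.Lmodule.copy (HCalg nz) HC.
HB.instance Definition _ := GRing.PzSemiRing_isNonZero.Build (HCalg nz) nz.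
HB.instance Definition _ :=
  GRing.LSemiModule_isLSemiAlgebra.Build R (HCalg nz) (@HC_scalerAl R q n).
HB.instance Definition _ :=
  GRing.LSemiAlgebra_isSemiAlgebra.Build R (HCalg nz) (@HC_scalerAr R q n).

Local Notation A := (HCalg nz).
Local Notation T := (genT q n : nat -> A).
Local Notation C := (genC q n : nat -> A).
Local Notation word := (word T C).

Lemma HC_presentation : presentation (epsilon q) n T C.
Proof.
split.
- exact: genTT.
- exact: genT_comm.
- exact: genT_braid.
- exact: genCC.
- exact: genC_anti.
- exact: genTC0.
- exact: genTC1.
- exact: genTC.
Qed.

Definition letter_of (g : generator n) : letter :=
  match g with inl i => inl (val i) | inr j => inr (val j) end.

Lemma word_monom (m : {fmonom generator n}) :
  HC_pi q (<< m >> : free_alg R n) = word [seq letter_of x | x <- m].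
Proof.
case: m; elim=> [|g s IHs].
  rewrite /= word_nil.
  have -> : FMonom [::] = mone :> {fmonom generator n} by apply/val_inj;
    rewrite /= fm1.
  by [].
rewrite /= word_cons -{}IHs.
have -> : FMonom (g :: s) = mmul (fmu g) (FMonom s) :> {fmonom generator n}.
  by apply/val_inj; rewrite /= fmM fmU.
have -> : << mmul (fmu g) (FMonom s) >> =
  << fmu g >> * << FMonom s >> :> free_alg R n.
  by rewrite malgM_def fgmulUU mulr1.
rewrite -HC_piMr; congr (_ * _).
by case: g => i /=; rewrite ?genT_ord ?genC_ord.
Qed.

Lemma letter_of_map s : all (in_rank n.-1 n) s ->
  exists s', s = [seq letter_of x | x <- s'].
Proof.
elim: s => [|x s IHs] /=; first by exists [::].
move=> /andP[hx /IHs[s' ->]]; case: x hx => i hi.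
  by exists (inl (Ordinal hi) :: s').
by exists (inr (Ordinal hi) :: s').
Qed.

Lemma subalg_full (h : A) : subalg T C n.-1 n h.
Proof.
rewrite -[h]HC_pi_repr; move: (generic_quotient.repr h) => g.
rewrite [g]monalgE; elim/big_rec: _ => [|m g' _ IHg].
  by rewrite HC_pi0; apply: span0.
rewrite HC_piDr; apply: spanD => //.
have -> : << g@_m *g m >> = g@_m *: << m >> :> free_alg R n.
  by rewrite -mul_malgC malgM_def fgmulUU mul1m mulr1.
rewrite -HC_piZr; apply: spanZ; exists [seq letter_of x | x <- m].
  by rewrite all_map; apply/allP => -[i|i] _ /=.
exact: word_monom.
Qed.

Lemma word_odd s : all (in_rank n.-1 n) s -> odd (count isC s) ->
  has_parity true (word s : HC).
Proof.
move=> /letter_of_map[s' ->]; rewrite count_map => odd_s'.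
have := word_monom (FMonom s'); rewrite /= => <-.
exists << FMonom s' >> => // m; rewrite mcoeffU1.
case: (FMonom s' =P m) => [<- _|_]; last by rewrite eqxx.
rewrite -odd_s' /=; congr (odd _).
by apply: eq_count => -[i|i].
Qed.

Lemma HC_prodT (s : seq 'I_n.-1) :
  \prod_(i <- s) HC_T q i = Tword T [seq val i | i <- s].
Proof.
by rewrite /Tword big_map; apply: eq_bigr => i _; rewrite genT_ord.
Qed.

Lemma HC_Tw_normal (s : seq 'I_n.-1) : normal_word n.-1 [seq val i | i <- s] ->
  HC_Tw q (word_perm s) = Tword T [seq val i | i <- s].
Proof.
move=> hs; rewrite /HC_Tw HC_prodT;
  apply: (braid_eq_Tword HC_presentation (m := n.-1)).
apply: reduced_word_normal => //.
have := @xgetPex _ [::] [set t | reduced_word (word_perm s) t]%classic.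
by apply; apply: (reduced_word_exists (s := s)).
Qed.

Lemma HC_Tw_odd nu : all odd nu -> sumn nu = n ->
  HC_Tw q (w_odd n nu) = Tword T (blocks 0 nu).
Proof.
move=> onu snu.
have pos : all (leq 1) nu by apply: sub_all onu => -[].
pose s := [seq i : 'I_n.-1 <- enum 'I_n.-1 | i.+1 \notin block_ends nu].
have E : blocks 0 nu = [seq val i | i <- s].
  rewrite blocks_filter // snu (eq_map (g := id)) // map_id.
  by rewrite -val_enum_ord filter_map.
have -> : w_odd n nu = word_perm s.
  by rewrite /w_odd /word_perm big_filter [index_enum _]unlock -enumT.
rewrite E; apply: HC_Tw_normal; rewrite -E blocks_filter // snu.
exact: normal_word_filter.
Qed.

Lemma HC_CpowE (f : nat -> bool) :
  HC_Cpow q [ffun j : 'I_n => (f j)%:R] = Cpow n C f.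
Proof.
have E : iota 0 n = index_iota 0 n by rewrite /index_iota subn0.
rewrite /Cpow /HC_Cpow E big_mkord.
by apply: eq_bigr => j _; rewrite ffunE genC_ord; case: (f j).
Qed.

Lemma tau_normal (tau : {scalar HC}) : is_tau tau -> forall f u,
    normal_word n.-1 u ->
  (tau : {scalar A}) (Cpow n C f * Tword T u) =
    (all (fun i => ~~ f i) (iota 0 n) && (u == [::]))%:R.
Proof.
move=> tauP f u hu; have [s us] := ord_word (normal_word_lt hu).
rewrite us in hu *; rewrite -HC_Tw_normal // -HC_CpowE.
have := tauP [ffun j : 'I_n => (f j)%:R] (word_perm s) => ->.
congr ((_ && _) : bool)%:R.
  apply/eqP/allP => [E i|E].
    rewrite mem_iota add0n => /= hi; have := congr1 (fun h : {ffun 'I_n ->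
      'Z_2} => h (Ordinal hi)) E.
    by rewrite !ffunE /=; case: (f i).
  apply/ffunP => j; rewrite !ffunE; have := E j.
  by rewrite mem_iota add0n ltn_ord => /(_ isT) /negPf ->.
apply/eqP/eqP => [E|]; last by case: s us hu => // _ _;
  rewrite /word_perm big_nil.
rewrite (word_perm_inj hu (t := [::])) //; first exact: normal_word_nil.
by rewrite E /word_perm big_nil.
Qed.

Lemma HC_X_E k : (k < n)%N -> HC_X q n k = jucys_murphy (epsilon q) T C k.
Proof.
elim: k => // k IHk kn; rewrite /= -(IHk (ltnW kn)).
have kn' : (k < n.-1)%N by lia.
rewrite insubT; set i := Sub k kn'.
by rewrite -(genT_ord q i) -(genC_ord q (pos0 i)) -(genC_ord q (pos1 i)).
Qed.

Lemma Xprod_E : \prod_(k < n) (1 + HC_X q n k) = Xprod (epsilon q) T C n.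
Proof. by apply: eq_bigr => k _; rewrite HC_X_E. Qed.
End Bridge.

(** The form takes the value 1 at a basis element. *)
Lemma HC_nontrivial (R : idomainType) (q : R) (n : nat)
    (tau : {scalar HC q n}) : is_tau tau -> (1 : HC q n) != 0.
Proof.
move=> tauP; apply/eqP => E; have := tauP 0 1%g; rewrite !eqxx /=.
rewrite -[_ * _]mul1r E mul0r raddf0 => /esym/eqP; exact/negP/oner_neq0.
Qed.

Theorem proposition1p5 (R : idomainType) (q : R) (n : nat)
    (char_not_2 : 2%N \notin [pchar R])
    (two_unit : (2%:R : R) \is a GRing.unit)
    (q_unit : q \is a GRing.unit)
    (q_neq1 : q != 1) (q_neqN1 : q != -1)
    (q_qV_unit : q + q^-1 \is a GRing.unit)
    (n_gt0 : (1 <= n)%N)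
    (tau : {scalar HC q n}) (tauP : is_tau tau)
    (gimel : {scalar HC q n}) (gimelP : is_gimel gimel) :
  forall h : HC q n, gimel h = (2%:R ^+ n)^-1 * t_form tau h.
Proof.
move=> h; have nz := HC_nontrivial tauP; have [[gM g_odd] g_val] := gimelP.
pose A := HCalg nz; pose e := epsilon q.
have zE : e = 2%:R * (e / 2%:R) by rewrite mulrCA divrr ?mulr1.
have gC s : all (in_rank n.-1 n) s -> odd (count isC s) ->
    (gimel : {scalar A}) (word (genT q n : nat -> A) (genC q n) s) = 0.
  by move=> hs os; apply/g_odd/(word_odd nz).
have gv nu : sorted geq nu -> all odd nu -> sumn nu = n ->
    (gimel : {scalar A}) (Tword (genT q n : nat -> A) (blocks 0 nu)) =
      (e / 2%:R) ^+ (n - size nu).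
  move=> snu onu sumnu; rewrite -(HC_Tw_odd nz) // g_val // /odd_partition.
  by rewrite snu onu sumnu eqxx.
have := @trace_eq_tau _ _ _ _ _ _ (HC_presentation nz) tau (tau_normal nz tauP)
  gimel gM gC two_unit _ zE gv h n_gt0 (@subalg_full _ _ _ nz h).
rewrite -Xprod_E => E; rewrite /t_form; apply: (mulrI (unitrX n two_unit)).
by rewrite mulVKr ?unitrX.
Qed.
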